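(* Let $\mathbb{K}$ be a field and let $\mathcal{S}$ be a triangle mush in $\mathbb{K}[T_1,\dots,T_r]$. Then the algorithm MakeTriangular (described in the context), applied to $\mathcal{S}$, terminates, and its output $\mathcal{S}'$ is a triangle mush that is equivalent to $\mathcal{S}$ and consists of triangular systems.
   Context: Fix the lexicographic ordering $T_1>\dots>T_r$ on $\mathbb{K}[T_1,\dots,T_r]$ and an algebraic closure $\overline{\mathbb{K}}$ of $\mathbb{K}$. Polynomials $f_1,\dots,f_s$ are of *triangular shape* if for each $f_j$ there is $1\le k(f_j)\le r$ such that $k(f_1)<\dots<k(f_s)$ and $f_j\in\mathbb{K}[T_{k(f_j)},\dots,T_r]\setminus\mathbb{K}[T_{k(f_j)+1},\dots,T_r]$ for each $j$. $\deg_{T_i}(f)$ is the degree of $f$ as a polynomial in $T_i$, and $\mathrm{LC}_{i}(f)$ is the leading coefficient of $f$ as a polynomial in $T_i$; in particular $\mathrm{LC}_{k(f)}(f)\in\mathbb{K}[T_{k(f)+1},\dots,T_r]$. A *semi-triangular system* is a tuple $(\mathcal{F}_\square,\mathcal{F}_\lhd,k,g)$ of finite subsets $\mathcal{F}_\square,\mathcal{F}_\lhd\subseteq\mathbb{K}[T_1,\dots,T_r]$, an integer $0\le k\le r$ and a polynomial $g\in\mathbb{K}[T_1,\dots,T_r]$ such that: $\mathcal{F}_\lhd$ is of triangular shape; $\mathrm{LC}_{k(f)}(f)\mid g$ for all $f\in\mathcal{F}_\lhd$; $\{1,\dots,k\}$ contains $\{k(f): f\in\mathcal{F}_\lhd\}$;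 $\deg_{T_i}(f)=0$ for all $f\in\mathcal{F}_\square$ and $1\le i\le k$. It is a *triangular system* if $\mathcal{F}_\square\subseteq\mathbb{K}$. A list $\mathcal{S}$ of semi-triangular systems is a *triangle mush*; its set of solutions is $$V(\mathcal{S}):=\bigcup_{(\mathcal{F}_\square,\mathcal{F}_\lhd,k,g)\in\mathcal{S}}V(\mathcal{F}_\square\cup\mathcal{F}_\lhd)\setminus V(g)\subseteq\overline{\mathbb{K}}^r,$$ and two triangle mushes $\mathcal{S},\mathcal{S}'$ are *equivalent* if $V(\mathcal{S})=V(\mathcal{S}')$. $\mathrm{LT}$ denotes the leading term (of a polynomial, or of the elements of a set) with respect to the ordering. The *reduction* of a finite set $\mathcal{F}$ of polynomials is a finite set $\mathrm{red}(\mathcal{F})$ of polynomials such that $\mathrm{LT}(f_1)\nmid\mathrm{LT}(f_2)$ for all distinct $f_1,f_2\in\mathrm{red}(\mathcal{F})$, $\langle\mathrm{LT}(\mathcal{F})\rangle\subseteq\langle\mathrm{LT}(\mathrm{red}(\mathcal{F}))\rangle$ and $\langle\mathcal{F}\rangle=\langle\mathrm{red}(\mathcal{F})\rangle$. Computing it means successively applying the division algorithm to the elements of $\mathcal{F}$. **MakeTriangular.** Input: a triangle mush $\mathcal{S}$ in $\mathbb{K}[T_1,\dots,T_r]$. While there is $S=(\mathcal{F}_\square,\mathcal{F}_\lhd,k,g)\in\mathcal{S}$ with $k<r$: replace $\mathcal{F}_\square$ by $\mathrm{red}(\mathcal{F}_\square)$; then do the following. (a) If there is $f\in\mathcal{F}_\square$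 with $\deg_{T_{k+1}}(f)>0$ and there is $h\in\mathcal{F}_\square\setminus\{f\}$ with $\deg_{T_{k+1}}(h)>0$: perform a polynomial division of $f$ by $h$ in the univariate polynomial ring $\mathbb{K}(T_{k+2},\dots,T_r)[T_{k+1}]$ to obtain $f=a'h+u'$. Set $b:=\mathrm{LC}_{k+1}(h)\in\mathbb{K}[T_{k+2},\dots,T_r]$ and $j:=\deg_{T_{k+1}}(h)+1\in\mathbb{Z}_{\ge0}$. With $a:=b^ja'$ and $u:=b^ju'\in\mathbb{K}[T_{k+1},\dots,T_r]$ one then has $b^jf=ah+u\in\mathbb{K}[T_{k+1},\dots,T_r]$. Redefine $\mathcal{S}:=(\mathcal{S}\setminus\{S\})\cup\{S',S''\}$, where $S':=((\mathcal{F}_\square\setminus\{f\})\cup\{u\},\mathcal{F}_\lhd,k,bg)$ and $S'':=(\mathcal{F}_\square\cup\{b\},\mathcal{F}_\lhd,k,g)$. (b) If there is such an $f$ but no such $h$: write $f=\sum_{i=0}^d a_iT_{k+1}^i$ with $a_i\in\mathbb{K}[T_{k+2},\dots,T_r]$, and for $-1\le j\le d$ put $f_j:=\sum_{i=0}^ja_iT_{k+1}^i$, $\mathcal{F}_\lhd^j:=\mathcal{F}_\lhd\cup\{f_j\}$ and $\mathcal{F}_\square^j:=(\mathcal{F}_\square\setminus\{f\})\cup\{a_{j+1},\dots,a_d\}$. Redefine $\mathcal{S}:=(\mathcal{S}\setminus\{S\})\cup\{S',S_1,\dots,S_d\}$, where $S':=(\mathcal{F}_\square^{-1},\mathcal{F}_\lhd,k+1,g)$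 and $S_j:=(\mathcal{F}_\square^j,\mathcal{F}_\lhd^j,k+1,ga_j)$ for $1\le j\le d$. (c) If there is no such $f$: redefine $\mathcal{S}:=(\mathcal{S}\setminus\{S\})\cup\{S'\}$, where $S':=(\mathcal{F}_\square,\mathcal{F}_\lhd,k+1,g)$. Output: $\mathcal{S}'$, the final value of $\mathcal{S}$.
   Formalization: The algorithm as printed can fail; here (a) only divides f by h with deg h ≤ deg f, j is raised above deg(h)+1 when that power of b leaves denominators, (b) omits the S_j with a_j = 0 (which have no solutions), and red(F) is any result of successive division. *)

(* Defs.v *)
From HB Require Import structures.
From Stdlib Require Export Relation_Operators.
From mathcomp Require Export all_boot all_order all_algebra.
From mathcomp Require Export finmap mpoly.

Set Implicit Arguments.
Unset Strict Implicit.
Unset Printing Implicit Defensive.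

Import GRing.Theory.

Local Open Scope fset_scope.
Local Open Scope ring_scope.

(* Variables are indexed from 0: T_(i+1) is 'X_i for i : 'I_r.    *)
(* The function k(f) is shifted accordingly (an element of 'I_r), while the   *)
(* counter k of a system, 0 <= k <= r, is not: {1, ..., k} becomes            *)
(* {i : 'I_r | i < k}, and T_(k+1) is 'X_i for the i : 'I_r with value k.     *)

Section MonomialOrder.
Variables (K : fieldType) (r : nat).
Implicit Types (f g p q u : {mpoly K[r]}) (F G : {fset {mpoly K[r]}}).

(* The order built into mpoly.v compares total degrees first; this is the     *)
(* pure lexicographic order with T_1 > ... > T_r.                             *)
Definition lex_le (m1 m2 : 'X_{1..r}) : bool :=
  ((m1 : seqlexi nat) <= (m2 : seqlexi nat))%O.

Definition lex_max (m1 m2 : 'X_{1..r}) := if lex_le m1 m2 then m2 else m1.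

(* 0%MM (the least monomial) if f = 0 *)
Definition LM f : 'X_{1..r} := \big[lex_max/0%MM]_(m <- msupp f) m.

(* LT 0 = 0 *)
Definition LT f : {mpoly K[r]} := f@_(LM f) *: 'X_[LM f].

Definition pdvd f g : Prop := exists q, g = q * f.

Definition ideal_gen F p : Prop :=
  exists q : {mpoly K[r]} -> {mpoly K[r]}, p = \sum_(f <- F) q f * f.

Definition LTs F : {fset {mpoly K[r]}} := [fset LT f | f in F].

(* u is an output of the division algorithm for the division of p by G *)
Definition remainder p G u : Prop :=
  exists q : {mpoly K[r]} -> {mpoly K[r]},
    [/\ p = \sum_(g <- G) q g * g + u,
        {in G, forall g, q g * g != 0 -> lex_le (LM (q g * g)) (LM p)} &
        {in msupp u & G, forall m g, ~ pdvd (LT g) 'X_[m]}].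

(* Successive replacement of an element by a remainder on division by the     *)
(* others; zero remainders are discarded.                                     *)
Inductive interreduces F : {fset {mpoly K[r]}} -> Prop :=
| InterRefl : interreduces F F
| InterStep G p u : interreduces F G -> p \in G -> remainder p (G `\ p) u ->
    interreduces F (if u == 0 then G `\ p else u |` (G `\ p)).

(* The last two clauses follow from the first one. *)
Definition is_red F G : Prop :=
  [/\ interreduces F G,
      {in G &, forall f1 f2, f1 != f2 -> ~ pdvd (LT f1) (LT f2)},
      (forall p, ideal_gen (LTs F) p -> ideal_gen (LTs G) p) &
      (forall p, ideal_gen F p <-> ideal_gen G p)].

End MonomialOrder.

Section Univariate.
Variables (K : fieldType) (r : nat) (i : 'I_r).
Implicit Types (f h a u : {mpoly K[r]}).

(* f as a polynomial in T_(i+1): its coefficients do not involve 'X_i *)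
Definition uni f : {poly {mpoly K[r]}} :=
  mmap (polyC \o @mpolyC r K)
       (fun j : 'I_r => if j == i then 'X else ('X_j)%:P) f.

(* The degree of 0 is taken to be 0, so that 0 may occur in F_square. *)
Definition deg f : nat := (size (uni f)).-1.

Definition LC f : {mpoly K[r]} := lead_coef (uni f).

(* When f and h are in K[T_(i+1), ..., T_r], division in                      *)
(* K(T_(i+2), ..., T_r)[T_(i+1)] is division over the larger coefficient      *)
(* field K(T_1, ..., T_r).                                                    *)
Definition univF f : {poly {fraction {mpoly K[r]}}} :=
  map_poly (@FracField.tofrac {mpoly K[r]}) (uni f).

(* a = b^j a' and u = b^j u' are polynomials, where f = a' h + u' and b is    *)
(* the leading coefficient of h                                               *)
Definition cleared_division f h (j : nat) a u : Prop :=
  univF a = FracField.tofrac (LC h ^+ j) *: (univF f %/ univF h) /\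
  univF u = FracField.tofrac (LC h ^+ j) *: (univF f %% univF h).

Definition clears f h j : Prop := exists a u, cleared_division f h j a u.

(* j = deg h + 1 whenever this exponent clears the denominators; otherwise    *)
(* the next exponent that does. For f = T1^3, h = T1 T2 + 1 it is 3, not 2.   *)
Definition exponent f h j : Prop :=
  [/\ (deg h < j)%N, clears f h j &
      forall j', (deg h < j' < j)%N -> ~ clears f h j'].

Definition truncation f (j : nat) : {mpoly K[r]} :=
  \sum_(l < j.+1) (uni f)`_l * 'X_i ^+ l.

(* {a_j, ..., a_d} for f = a_0 + ... + a_d T_(i+1)^d *)
Definition coefs_from f (j : nat) : {fset {mpoly K[r]}} :=
  [fset c in drop j (uni f)].

End Univariate.

Record system (K : fieldType) (r : nat) := System {
  square : {fset {mpoly K[r]}};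
  tri    : {fset {mpoly K[r]}};
  lvl    : nat;
  ineq   : {mpoly K[r]}
}.

Section SystemChoice.
Variables (K : fieldType) (r : nat).

Definition system_to_tuple (s : system K r) :=
  (square s, tri s, lvl s, ineq s).

Definition system_of_tuple
    (t : {fset {mpoly K[r]}} * {fset {mpoly K[r]}} * nat * {mpoly K[r]}) :=
  let: (F, G, k, g) := t in System F G k g.

Lemma system_to_tupleK : cancel system_to_tuple system_of_tuple.
Proof. by case. Qed.

HB.instance Definition _ :=
  Choice.copy (system K r) (can_type system_to_tupleK).

End SystemChoice.

Section Systems.
Variables (K : fieldType) (r : nat).
Implicit Types (f g : {mpoly K[r]}) (F : {fset {mpoly K[r]}}).
Implicit Types (s : system K r) (S : {fset system K r}).

(* f is in K[T_(n+1), ..., T_r] *)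
Definition only_vars_from (n : nat) f : Prop :=
  {in msupp f, forall (m : 'X_{1..r}) (i : 'I_r), (i < n)%N -> m i = 0%N}.

(* i + 1 = k(f) *)
Definition main_var f (i : 'I_r) : Prop :=
  only_vars_from i f /\ ~ only_vars_from i.+1 f.

Definition triangular_shape F : Prop :=
  exists fk : seq ({mpoly K[r]} * 'I_r),
    [/\ F =i [seq p.1 | p <- fk], {in fk, forall p, main_var p.1 p.2} &
        sorted ltn [seq nat_of_ord p.2 | p <- fk]].

Definition semi_triangular s : Prop :=
  [/\ (lvl s <= r)%N,
      triangular_shape (tri s),
      {in tri s, forall f i, main_var f i -> pdvd (LC i f) (ineq s)},
      {in tri s, forall f i, main_var f i -> (i < lvl s)%N} &
      {in square s, forall f (i : 'I_r), (i < lvl s)%N -> deg i f = 0%N}].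

Definition triangular_system s : Prop :=
  semi_triangular s /\ {in square s, forall f, exists c : K, f = c%:MP}.

(* A list of systems is only used through the set of its members. *)
Definition triangle_mush S : Prop := {in S, forall s, semi_triangular s}.

End Systems.

Section Solutions.
Variables (K : fieldType) (L : closedFieldType) (iota : {rmorphism K -> L}).
Variable r : nat.

Definition solution (S : {fset system K r}) (x : 'I_r -> L) : Prop :=
  exists2 s, s \in S &
    {in square s `|` tri s, forall f, (map_mpoly iota f).@[x] = 0} /\
    (map_mpoly iota (ineq s)).@[x] <> 0.

Definition equivalent (S S' : {fset system K r}) : Prop :=
  forall x, solution S x <-> solution S' x.

End Solutions.

Section Algorithm.
Variables (K : fieldType) (r : nat).
Implicit Types (f g h : {mpoly K[r]}) (F : {fset {mpoly K[r]}}).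
Implicit Types (s : system K r) (S T : {fset system K r}).

Definition with_square s F := System F (tri s) (lvl s) (ineq s).

(* Division presupposes deg h <= deg f: otherwise its only effect is to       *)
(* replace f by b^j f, which could be repeated forever on {T1 T3, T1^2 T2}.   *)
Definition selected_pair (i : 'I_r) F f h : Prop :=
  [/\ f \in F, h \in F, h != f, (0 < deg i h)%N & (deg i h <= deg i f)%N].

(* The systems S_j with a_j = 0, which have inequation 0 and hence no         *)
(* solutions, are left out: f_j has degree < j, and F_tri with f_j added need *)
(* not be of triangular shape.                                                *)
Definition split_off (i : 'I_r) s f : {fset system K r} :=
  let F := square s `\ f in
  System (F `|` coefs_from i f 0) (tri s) (lvl s).+1 (ineq s) |`
  [fset System (F `|` coefs_from i f j.+1) (truncation i f j |` tri s)
               (lvl s).+1 (ineq s * (uni i f)`_j)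
     | j in [seq j <- iota 1 (deg i f) | (uni i f)`_j != 0]].

(* replacement s N: s, with reduced F_square, is replaced by the systems in N *)
Variant replacement s : {fset system K r} -> Prop :=
| CaseDivide (i : 'I_r) f h j a u of
    i = lvl s :> nat & selected_pair i (square s) f h &
    exponent i f h j & cleared_division i f h j a u :
    replacement s
      [fset System (u |` (square s `\ f)) (tri s) (lvl s) (LC i h * ineq s);
            System (LC i h |` square s) (tri s) (lvl s) (ineq s)]
| CaseSplit (i : 'I_r) f of
    i = lvl s :> nat & f \in square s & (0 < deg i f)%N &
    {in square s `\ f, forall h, deg i h = 0%N} :
    replacement s (split_off i s f)
| CaseSkip (i : 'I_r) of
    i = lvl s :> nat & {in square s, forall f, deg i f = 0%N} :
    replacement s [fset System (square s) (tri s) (lvl s).+1 (ineq s)].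

(* one pass through the loop *)
Definition step S T : Prop :=
  exists s F N,
    let s' := with_square s F in
    [/\ s \in S, (lvl s < r)%N, is_red (square s) F, replacement s' N &
        T = ((s' |` (S `\ s)) `\ s') `|` N].

Definition reachable S T : Prop := clos_refl_trans _ step S T.

(* The pass for s can be carried out, whatever the intermediate choices. *)
Definition executable s : Prop :=
  (exists F, is_red (square s) F) /\
  (forall F, is_red (square s) F ->
    (exists N, replacement (with_square s F) N) /\
    (forall (i : 'I_r) f h, i = lvl s :> nat -> selected_pair i F f h ->
       exists j, exponent i f h j)).

(* There is no infinite run, and no run gets stuck. *)
Definition terminates S : Prop :=
  Acc (fun T' T => step T T') S /\
  (forall T s, reachable S T -> s \in T -> (lvl s < r)%N -> executable s).

Definition output S S' : Prop :=
  reachable S S' /\ {in S', forall s, ~ (lvl s < r)%N}.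

End Algorithm.

(* Main.v *)
Require Import Defs.
From HB Require Import structures.
From Stdlib Require Import Classical ClassicalEpsilon Inverse_Image.
From mathcomp Require Import all_boot all_order all_algebra finmap mpoly.

(** A run stops because each pass replaces one system by finitely many simpler
    ones, for a well-founded relation [simpler], and finite sets of systems are
    then well-founded under such replacements ([fset_below_wf], the multiset
    order). The relation is lexicographic in three quantities: the level; the sum
    of the degrees of the square part in the current variable; and the ideal of
    leading monomials of the square part, which can grow only finitely often by
    Dickson's lemma ([grows_wf]). Splitting and skipping raise the level. Division
    of [f] by [h], where [h] has at most the degree of [f], gives one system in
    which [f] has become its remainder, of degree less than that of [h], and one
    in which [LC h] has joined the square part. As [LC h] has degree zero in the
    current variable, the sum of degrees is the same as before; but in a reduced
    set its leading monomial is new, being a proper divisor of that of [h]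
    ([grows_LC]). The reduction at the start of a pass spoils none of this: it
    replaces polynomials by remainders without larger monomials, whose degree in
    the current variable, the leading one among those that occur, is no larger
    either ([interreduces_sumdeg]), and leading monomials stay in the ideal
    ([interreduces_LM_ideal]).

    No run gets stuck, because reduced sets exist (the division algorithm,
    [remainder_exists], repeated along the multiset order) and because a power of
    [LC h] clears the denominators of the division by [h] ([pseudo_division]).

    The solution set is preserved pass by pass ([solves_replacement]): a division
    distinguishes whether [LC h] vanishes, a split which coefficient of [f] is the
    last one not to vanish. Semi-triangularity is preserved likewise; only for the
    remainder [u] of a division does this need an argument, as [u] is defined
    over the field of fractions in all variables ([division_free]). At level [r]
    no variable is left for the square part. *)

Set Implicit Arguments.
Unset Strict Implicit.
Unset Printing Implicit Defensive.

Import Order.TTheory GRing.Theory.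
Local Open Scope fset_scope.
Local Open Scope ring_scope.

(** * Well-founded relations *)

Lemma no_descent_wf (T : Type) (R : T -> T -> Prop) :
  (forall u : nat -> T, ~ forall n, R (u n.+1) (u n)) -> well_founded R.
Proof.
move=> no_descent x; apply: NNPP => nAx.
have next (p : {x | ~ Acc R x}) : {q : {x | ~ Acc R x} | R (sval q) (sval p)}.
  apply: constructive_indefinite_description; case: p => y nAy /=.
  apply: NNPP => stuck; apply: nAy; constructor=> z Rzy; apply: NNPP => nAz.
  by apply: stuck; exists (exist _ z nAz).
pose u n := sval (iter n (fun p => sval (next p)) (exist _ x nAx)).
by apply: (no_descent u) => n; rewrite /u iterS; apply: (svalP (next _)).
Qed.

Section FsetOrder.
Variables (T : choiceType) (R : T -> T -> Prop).

Definition fset_below (A B : {fset T}) : Prop :=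
  exists2 x, x \in B & {in A, forall y, y \in B `\ x \/ R y x}.

Lemma Acc_fset_below_sub A B : A `<=` B -> Acc fset_below B -> Acc fset_below A.
Proof.
move=> /fsubsetP sAB accB; constructor=> C [x xA CA].
apply: (Acc_inv accB); exists x; first exact: sAB.
move=> y /CA [|]; last by right.
by rewrite !inE => /andP[-> /sAB ->]; left.
Qed.

(** The multiset order, for sets. Adding [x] to an accessible set keeps it
    accessible, by induction on [x] and then on the set. *)
Lemma fset_below_wf : well_founded R -> well_founded fset_below.
Proof.
move=> wfR; have add x B : Acc fset_below B -> Acc fset_below (x |` B).
  elim/(well_founded_induction wfR): x B => x IHx B.
  elim=> {}B accB IHB; have {}accB : Acc fset_below B by constructor.
  constructor=> A [z zxB Az]; have [zx|zx] := eqVneq z x.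
    rewrite zx in Az.
    (* [x] itself is replaced: its replacements are added to a part of [B]. *)
    suff addN (N : {fset T}) : {in N, forall y, R y x} ->
        Acc fset_below (N `|` [fset y in A | y \in B]).
      apply: (@Acc_fset_below_sub _
        ([fset y in A | y \notin B] `|` [fset y in A | y \in B])).
        by apply/fsubsetP=> y yA; rewrite !inE yA /=; case: (y \in B).
      apply: addN => y; rewrite !inE => /andP[yA yB].
      have [|//] := Az y yA; rewrite !inE (negPf yB) orbF.
      by case/andP=> /negPf->.
    elim/fset1U_rect: N => [|y N _ IHN] NR.
      rewrite fset0U; apply: Acc_fset_below_sub accB.
      by apply/fsubsetP=> y; rewrite !inE => /andP[].
    rewrite -fsetUA; apply: IHx; first by apply: NR; rewrite !inE eqxx.
    by apply: IHN => w wN; apply: NR; rewrite !inE wN orbT.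
  have zB : z \in B by move: zxB; rewrite !inE (negPf zx).
  apply: (@Acc_fset_below_sub _ (x |` (A `\ x))).
    by apply/fsubsetP=> y yA; rewrite !inE yA andbT orbN.
  apply: IHB; exists z => // y; rewrite !inE => /andP[yx /Az].
  by rewrite !inE (negPf yx).
move=> A; elim/fset1U_rect: A => [|x A _ accA]; last exact: add.
by constructor=> B [].
Qed.

End FsetOrder.

(** * Dickson's lemma *)

(** Pass repeatedly to a place where the minimum of the remaining tail is
    attained. *)
Lemma nondecreasing_subsequence (f : nat -> nat) :
  exists phi : nat -> nat,
    (forall n, phi n < phi n.+1)%N /\ (forall n, f (phi n) <= f (phi n.+1))%N.
Proof.
have tail_min n :
    {k | (n <= k)%N /\ forall l, (k <= l)%N -> (f k <= f l)%N}.
  apply: constructive_indefinite_description.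
  have [v] := ubnP (f n); elim: v => // v IHv in n *; rewrite ltnS => fnv.
  have [] := classic (exists2 l, (n <= l)%N & (f l < f n)%N).
    case=> l nl fl; have [|k [lk kmin]] := IHv l; first exact: leq_trans fl _.
    by exists k; split=> //; apply: leq_trans lk.
  move=> nmin; exists n; split=> // l nl; rewrite leqNgt; apply/negP=> fl.
  by apply: nmin; exists l.
pose phi n := iter n (fun k => sval (tail_min k.+1)) (sval (tail_min 0%N)).
have incr n : (phi n < phi n.+1)%N by case: (svalP (tail_min (phi n).+1)).
exists phi; split=> // n.
have phi_min : forall l, (phi n <= l)%N -> (f (phi n) <= f l)%N.
  by case: n => [|n]; [case: (svalP (tail_min 0)) |
                       case: (svalP (tail_min (phi n).+1))].
exact/phi_min/ltnW.
Qed.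

(** Subsequences are extracted one coordinate at a time. *)
Lemma dickson (r : nat) (u : nat -> 'X_{1..r}) :
  exists i j, (i < j)%N /\ (u i <= u j)%MM.
Proof.
suff H n : (n <= r)%N -> exists phi : nat -> nat,
    (forall k, phi k < phi k.+1)%N /\
    forall (i : 'I_r) k, (i < n)%N -> (u (phi k) i <= u (phi k.+1) i)%N.
  have [phi [incr mono]] := H r (leqnn r); exists (phi 0%N), (phi 1%N).
  by split=> //; apply/mnm_lepP => i; apply: mono.
elim: n => [|n IHn] nr; first by exists id.
have [phi [incr mono]] := IHn (ltnW nr).
have [psi [incr' mono']] :=
  nondecreasing_subsequence (fun k => u (phi k) (Ordinal nr)).
exists (phi \o psi); split=> [k|i k].
  by apply: (homo_ltn (r := fun a b => (a < b)%N)) (incr' k) => // ? ? ?;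
    apply: ltn_trans.
rewrite ltnS leq_eqVlt => /orP[/eqP in_|ltin]; last first.
  apply: (homo_leq (f := fun l => u (phi l) i) (r := fun a b => (a <= b)%N))
    (ltnW (incr' k)) => // [? ? ?|l]; [exact: leq_trans | exact: mono].
have -> : i = Ordinal nr by apply: val_inj.
exact: mono'.
Qed.

(** Strict growth of up-closed sets of monomials: strict inclusion of monomial
    ideals. *)
Definition grows (r : nat) (V U : 'X_{1..r} -> Prop) : Prop :=
  [/\ forall m m', (m <= m')%MM -> V m -> V m', forall m, U m -> V m &
      exists2 m, V m & ~ U m].

(** In an infinite ascending chain no monomial new at one stage divides one that
    is new at a later stage, against Dickson's lemma. *)
Lemma grows_wf r : well_founded (@grows r).
Proof.
apply: no_descent_wf => U Ugrows.
have new n : {m | U n.+1 m & ~ U n m}.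
  have /constructive_indefinite_description[m []] :
    exists m, U n.+1 m /\ ~ U n m by case: (Ugrows n) => _ _ [m]; exists m.
  by exists m.
have [i [j [ij mij]]] := dickson (fun n => s2val (new n)).
have mono k : forall m, U i.+1 m -> U (i.+1 + k)%N m.
  elim: k => [|k IHk] m Um; first by rewrite addn0.
  by rewrite addnS; case: (Ugrows (i.+1 + k)%N) => _ incl _; apply/incl/IHk.
apply: (s2valP' (new j)); case: j ij mij => // j ij mij.
case: (Ugrows j) => up _ _; apply: up mij _.
by rewrite -(subnKC ij); apply: mono; apply: (s2valP (new i)).
Qed.

(** * The lexicographic order *)

Section Lex.
Variable r : nat.
Implicit Types m : 'X_{1..r}.

Definition lex_lt m1 m2 := ~~ lex_le m2 m1.

Lemma lex_ltP m1 m2 :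
  reflect (exists2 i : 'I_r, forall j : 'I_r, (j < i)%N -> m1 j = m2 j &
                             (m1 i < m2 i)%N)
          (lex_lt m1 m2).
Proof. by rewrite /lex_lt /lex_le -ltNge; apply: ltxi_tuplePlt. Qed.

Lemma lex_refl : reflexive (@lex_le r).
Proof. by move=> m; apply: lexx. Qed.

Lemma lex_anti m1 m2 : lex_le m1 m2 -> lex_le m2 m1 -> m1 = m2.
Proof.
move=> le12 le21; do 2!apply: val_inj.
by apply: (@le_anti _ (seqlexi nat)); apply/andP.
Qed.

Lemma lex_trans : transitive (@lex_le r).
Proof. by move=> m2 m1 m3; apply: le_trans. Qed.

Lemma lex_ltW m1 m2 : lex_lt m1 m2 -> lex_le m1 m2.
Proof. by rewrite /lex_lt /lex_le -ltNge; apply: ltW. Qed.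

Lemma lex_lt_neqAle m1 m2 : lex_lt m1 m2 = (m1 != m2) && lex_le m1 m2.
Proof.
apply/idP/andP => [lt12|[neq12 le12]].
  by split; [apply: contraNneq lt12 => ->; apply: lex_refl | apply: lex_ltW].
by apply: contra neq12 => le21; apply/eqP/lex_anti.
Qed.

Lemma lex_leD2l m m1 m2 : lex_le (m + m1)%MM (m + m2)%MM = lex_le m1 m2.
Proof.
apply: negb_inj; apply/lex_ltP/lex_ltP => -[i eqi lti]; exists i.
- by move=> j /eqi /eqP; rewrite !mnmDE eqn_add2l => /eqP.
- by move: lti; rewrite !mnmDE ltn_add2l.
- by move=> j /eqi; rewrite !mnmDE => ->.
- by rewrite !mnmDE ltn_add2l.
Qed.

Lemma lex_leD2r m m1 m2 : lex_le (m1 + m)%MM (m2 + m)%MM = lex_le m1 m2.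
Proof. by rewrite ![(_ + m)%MM]addmC lex_leD2l. Qed.

Lemma lex_le_mnm m1 m2 : (m1 <= m2)%MM -> lex_le m1 m2.
Proof.
move=> /mnm_lepP le12; apply/negPn/lex_ltP => -[i _].
by rewrite ltnNge le12.
Qed.

Lemma lex_le0 m : lex_le 0%MM m.
Proof. by apply: lex_le_mnm; apply/mnm_lepP => i; rewrite mnm0E. Qed.

(** A descending chain would contain, by Dickson's lemma, a monomial dividing a
    later one, hence below it. *)
Lemma lex_wf : well_founded lex_lt.
Proof.
apply: no_descent_wf => u desc.
have [i [j [ij /lex_le_mnm le_ij]]] := dickson u.
have : lex_lt (u j) (u i).
  elim: j ij {le_ij} => // j IHj; rewrite ltnS leq_eqVlt => /orP[/eqP->//|ij].
  apply/negP => le_ij; move: (desc j) => /negP; apply.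
  by apply: lex_trans le_ij; apply/lex_ltW/IHj.
by rewrite /lex_lt le_ij.
Qed.

(** At the first variable in which the two monomials differ, the smaller one has
    the smaller exponent. *)
Lemma lex_le_vars (k : nat) m1 m2 :
    lex_le m1 m2 -> (forall i : 'I_r, (i < k)%N -> m2 i = 0%N) ->
  (forall i : 'I_r, (i < k)%N -> m1 i = 0%N) /\
  (forall i : 'I_r, i = k :> nat -> (m1 i <= m2 i)%N).
Proof.
move=> le12 m2_0; have [->//|neq12] := eqVneq m1 m2.
have /lex_ltP[i eqi lti] : lex_lt m1 m2 by rewrite lex_lt_neqAle neq12.
have ki : (k <= i)%N.
  by rewrite leqNgt; apply/negP => /m2_0 m2i; rewrite m2i in lti.
split=> j; first by move=> jk; rewrite eqi ?m2_0 // (leq_trans jk).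
move=> jk; have [ji|ji] := ltnP j i; first by rewrite eqi.
have -> : j = i by apply/val_inj/eqP; rewrite eqn_leq ji /= jk ki.
exact: ltnW.
Qed.

End Lex.

(** * Leading monomials *)

Section LeadingMonomial.
Variables (K : fieldType) (r : nat).
Implicit Types (p q f g u : {mpoly K[r]}) (F G : {fset {mpoly K[r]}}).
Implicit Types m : 'X_{1..r}.

Lemma lex_le_LM p m : m \in msupp p -> lex_le m (LM p).
Proof.
rewrite /LM; elim: (msupp p) => //= n s IHs; rewrite inE big_cons /lex_max.
case: ifP => [le_n|/negbT/lex_ltW le_s] /orP[/eqP-> //|/IHs //].
  by rewrite lex_refl.
by move=> le_m; apply: lex_trans le_s.
Qed.

Lemma LM_msupp p : p != 0 -> LM p \in msupp p.
Proof.
rewrite -msupp_eq0 /LM; elim: (msupp p) => // m [|n s] IHs _.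
  rewrite big_cons big_nil mem_seq1 /lex_max; case: ifP => // le_m0.
  by rewrite (lex_anti le_m0 (lex_le0 m)).
rewrite big_cons {1}/lex_max; case: ifP => _; last by rewrite mem_head.
by rewrite inE IHs ?orbT.
Qed.

Lemma LM_coef_neq0 p : p != 0 -> p@_(LM p) != 0.
Proof. by move=> p0; rewrite -mcoeff_msupp LM_msupp. Qed.

Lemma LM_eq p m : m \in msupp p -> {in msupp p, forall m', lex_le m' m} ->
  LM p = m.
Proof.
move=> mp le_m; apply: lex_anti; last exact: lex_le_LM.
by apply/le_m/LM_msupp; apply: contraTneq mp => ->; rewrite msupp0.
Qed.

Lemma LMM p q : p != 0 -> q != 0 -> LM (p * q) = (LM p + LM q)%MM.
Proof.
move=> p0 q0.
have le_sum m1 m2 : m1 \in msupp p -> m2 \in msupp q ->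
    lex_le (m1 + m2)%MM (LM p + LM q)%MM.
  move=> /lex_le_LM le1 /lex_le_LM le2.
  by apply: (@lex_trans _ (LM p + m2)%MM); rewrite ?lex_leD2l ?lex_leD2r.
apply: LM_eq => [|m /msuppM_le /allpairsP[[m1 m2] [/= ? ? ->]]]; last first.
  exact: le_sum.
have -> : p * q = \sum_(m <- msupp p) p@_m *: 'X_[m] * q.
  by rewrite {1}[p]mpolyE mulr_suml.
rewrite mcoeff_msupp raddf_sum /=.
rewrite (bigD1_seq (LM p)) ?LM_msupp ?msupp_uniq //= big1_seq.
  rewrite addr0 -scalerAl mcoeffZ -commr_mpolyX.
  by rewrite mcoeffMX mulf_neq0 ?LM_coef_neq0.
move=> m /andP[neq_m mp]; rewrite -scalerAl mcoeffZ.
apply/eqP; rewrite mulf_eq0; apply/orP; right.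
rewrite -commr_mpolyX mcoeff_eq0 (perm_mem (msuppMX _ _)).
apply/mapP => -[m' m'q] eq_sum; move/eqP: neq_m; apply; apply: lex_anti.
  exact: lex_le_LM.
rewrite -(lex_leD2r m') addmC; apply: (@lex_trans _ (LM p + LM q)%MM).
  by rewrite addmC lex_leD2l lex_le_LM.
by rewrite eq_sum lex_refl.
Qed.

Lemma pdvd_LT_X g m : pdvd (LT g) 'X_[m] <-> g != 0 /\ (LM g <= m)%MM.
Proof.
split=> [[q def_m]|[g0 le_m]].
  have m_in : m \in msupp (q * LT g).
    by rewrite -def_m msuppX mem_seq1.
  split.
    apply: contraTneq m_in => ->.
    by rewrite /LT mcoeff0 scale0r mulr0 msupp0.
  move: m_in; rewrite /LT -scalerAr => /msuppZ_le.
  by rewrite (perm_mem (msuppMX _ _)) => /mapP[m' _ ->]; rewrite lem_addr.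
exists ((g@_(LM g))^-1 *: 'X_[m - LM g]); rewrite /LT -scalerAl -scalerAr.
by rewrite scalerA mulVf ?LM_coef_neq0 // scale1r -mpolyXD submK.
Qed.

Lemma pdvd_LT p q : p != 0 -> q != 0 -> (LM p <= LM q)%MM -> pdvd (LT p) (LT q).
Proof.
move=> p0 q0 le_pq; have [|d def_q] := (pdvd_LT_X p (LM q)).2; first by [].
by exists (q@_(LM q) *: d); rewrite -scalerAl -def_q.
Qed.

(** Membership of a monomial in the ideal of the leading terms. *)
Definition LM_ideal F m : Prop := exists2 f, f \in F & f != 0 /\ (LM f <= m)%MM.

Lemma LM_ideal_up F m m' : (m <= m')%MM -> LM_ideal F m -> LM_ideal F m'.
Proof.
move=> le_m [f fF [f0 le_f]]; exists f => //; split=> //.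
exact: lepm_trans le_m.
Qed.

Lemma LM_idealS F G m : F `<=` G -> LM_ideal F m -> LM_ideal G m.
Proof. by move=> /fsubsetP sFG [f /sFG]; exists f. Qed.

End LeadingMonomial.

(** * Ideals and interreduction *)

Section Ideals.
Variables (K : fieldType) (r : nat).
Implicit Types (p q f g u : {mpoly K[r]}) (F G : {fset {mpoly K[r]}}).

Lemma ideal_gen_mem F f : f \in F -> ideal_gen F f.
Proof.
move=> fF; exists (fun g => (g == f)%:R).
rewrite (bigD1_seq f) ?fset_uniq //= eqxx mul1r big1 ?addr0 // => g /negPf->.
by rewrite mul0r.
Qed.

Lemma ideal_gen0 F : ideal_gen F 0.
Proof. by exists (fun => 0); rewrite big1 // => f; rewrite mul0r. Qed.

Lemma ideal_genD F p q : ideal_gen F p -> ideal_gen F q -> ideal_gen F (p + q).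
Proof.
move=> [a ->] [b ->]; exists (fun f => a f + b f); rewrite -big_split /=.
by apply: eq_bigr => f _; rewrite mulrDl.
Qed.

Lemma ideal_genM F p q : ideal_gen F p -> ideal_gen F (q * p).
Proof.
move=> [a ->]; exists (fun f => q * a f); rewrite mulr_sumr.
by apply: eq_bigr => f _; rewrite mulrA.
Qed.

Lemma ideal_gen_sum F (s : seq {mpoly K[r]})
    (q : {mpoly K[r]} -> {mpoly K[r]}) :
  {in s, forall f, ideal_gen F f} -> ideal_gen F (\sum_(f <- s) q f * f).
Proof.
elim: s => [|f s IHs] sF.
  by rewrite big_nil; exact: ideal_gen0.
rewrite big_cons; apply: ideal_genD; first by apply/ideal_genM/sF/mem_head.
by apply: IHs => g gs; apply: sF; rewrite inE gs orbT.
Qed.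

Lemma ideal_gen_sub F G p :
  {in F, forall f, ideal_gen G f} -> ideal_gen F p -> ideal_gen G p.
Proof. by move=> FG [q ->]; apply: ideal_gen_sum. Qed.

End Ideals.

Section Interreduction.
Variables (K : fieldType) (r : nat).
Implicit Types (p q f g u : {mpoly K[r]}) (F G : {fset {mpoly K[r]}}).
Implicit Types m : 'X_{1..r}.

Definition below p m : Prop := {in msupp p, forall m', lex_le m' m}.

Definition division_within m p G : Prop :=
  exists q : {mpoly K[r]} -> {mpoly K[r]}, exists u,
    [/\ p = \sum_(g <- G) q g * g + u, {in G, forall g, below (q g * g) m} &
        {in msupp u & G, forall m g, ~ pdvd (LT g) 'X_[m]}].

(** The division algorithm, by recursion on the monomial [m]: its term in [p] is
    either cancelled by a multiple of some [g] or moved to the remainder. *)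
Lemma division_below m p G : below p m -> division_within m p G.
Proof.
elim/(well_founded_induction (@lex_wf r)): m p => m IHm p le_p.
have rest p' : below p' m -> p'@_m = 0 -> division_within m p' G.
  move=> le_p' p'm; have [->|p'0] := eqVneq p' 0.
    exists (fun => 0), 0; split=> [|g _ m'|m' g]; last by rewrite msupp0.
      by rewrite big1 ?addr0 // => g _; rewrite mul0r.
    by rewrite mul0r msupp0.
  have lt_m : lex_lt (LM p') m.
    rewrite lex_lt_neqAle le_p' ?LM_msupp // andbT.
    by apply: contraTneq (LM_coef_neq0 p'0) => ->; rewrite p'm eqxx.
  have [q [u [def_p' le_q red_u]]] := IHm _ lt_m p' (@lex_le_LM _ _ p').
  exists q, u; split=> // g gG m' m'q.
  exact: lex_trans (le_q g gG m' m'q) (lex_ltW lt_m).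
have [[g gG /pdvd_LT_X[g0 le_m]]|irred] :=
    classic (exists2 g, g \in G & pdvd (LT g) 'X_[m]).
  pose t := (p@_m / g@_(LM g)) *: 'X_[m - LM g].
  have le_tg : below (t * g) m.
    move=> m'; rewrite /t -scalerAl => /msuppZ_le.
    rewrite -commr_mpolyX (perm_mem (msuppMX _ _)).
    move=> /mapP[m1 /lex_le_LM le1 ->].
    by rewrite -[X in lex_le _ X](submK le_m) lex_leD2l.
  have [||q [u [def_p' le_q red_u]]] := rest (p - t * g).
  - by move=> m' /msuppB_le; rewrite mem_cat => /orP[/le_p|/le_tg].
  - rewrite mcoeffB /t -scalerAl mcoeffZ -commr_mpolyX.
    have := mcoeffMX g (m - LM g)%MM (LM g); rewrite submK // => ->.
    by rewrite divfK ?subrr ?LM_coef_neq0.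
  exists (fun g' => q g' + (if g' == g then t else 0)), u; split=> //.
    rewrite -(subrK (t * g) p) {}def_p' addrAC; congr (_ + _).
    transitivity (\sum_(f <- G) (q f * f + (if f == g then t else 0) * f)).
      rewrite big_split /=; congr (_ + _).
      rewrite (bigD1_seq g) ?fset_uniq //= eqxx big1 ?addr0 // => f /negPf->.
      by rewrite mul0r.
    by apply: eq_bigr => f _; rewrite mulrDl.
  move=> f fG m'; rewrite mulrDl => /msuppD_le.
  rewrite mem_cat => /orP[/le_q->//|].
  by case: eqP => [->|_]; [apply: le_tg | rewrite mul0r msupp0].
have le_c : below (p@_m *: 'X_[m]) m.
  by move=> m' /msuppZ_le; rewrite msuppX mem_seq1 => /eqP->; apply: lex_refl.
have [||q [u [def_p' le_q red_u]]] := rest (p - p@_m *: 'X_[m]).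
- by move=> m' /msuppB_le; rewrite mem_cat => /orP[/le_p|/le_c].
- by rewrite mcoeffB mcoeffZ mcoeffX eqxx mulr1 subrr.
exists q, (u + p@_m *: 'X_[m]); split=> //.
  by rewrite addrA -def_p' subrK.
move=> m' g /msuppD_le.
rewrite mem_cat => /orP[m'u|/msuppZ_le]; first exact: red_u.
by rewrite msuppX mem_seq1 => /eqP-> gG dvd_m; apply: irred; exists g.
Qed.

Lemma remainder_exists p G : exists u, remainder p G u.
Proof.
have [q [u [def_p le_q red_u]]] := division_below G (@lex_le_LM _ _ p).
exists u, q; split=> // g gG qg0; exact: (le_q g gG _ (LM_msupp qg0)).
Qed.

Lemma remainder_supp p G u m : remainder p G u -> m \in msupp p ->
  m \in msupp u \/
  exists q g, [/\ g \in G, m \in msupp (q * g) & lex_le (LM (q * g)) (LM p)].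
Proof.
move=> [q [def_p le_q _]]; rewrite {1}def_p => /msuppD_le.
rewrite mem_cat => /orP[|]; last by left.
rewrite big_seq_cond => /msupp_sum_le /flattenP[s /mapP[g]].
rewrite mem_filter andbT => /andP[gG _] -> m_in; right.
exists (q g), g; split=> //.
by apply: le_q => //; apply: contraTneq m_in => ->; rewrite msupp0.
Qed.

Lemma remainder_le p G u :
  remainder p G u -> {in msupp u, forall m, lex_le m (LM p)}.
Proof.
move=> [q [def_p le_q _]] m.
rewrite (_ : u = p - \sum_(g <- G) q g * g); last first.
  by rewrite {1}def_p addrC addKr.
move=> /msuppB_le; rewrite mem_cat => /orP[/lex_le_LM //|].
rewrite big_seq_cond => /msupp_sum_le /flattenP[s /mapP[g]].
rewrite mem_filter andbT => /andP[gG _] -> m_in.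
apply: lex_trans (lex_le_LM m_in) (le_q g gG _).
by apply: contraTneq m_in => ->; rewrite msupp0.
Qed.

Definition exchange G p u := if u == 0 then G `\ p else u |` (G `\ p).

Lemma exchange_sub G p u : G `\ p `<=` exchange G p u.
Proof.
rewrite /exchange; case: ifP => _; first exact: fsubset_refl.
exact: fsubsetU1.
Qed.

Lemma exchange_mem G p u f :
  f \in exchange G p u -> f \in G `\ p \/ f = u /\ u != 0.
Proof.
rewrite /exchange; case: (eqVneq u 0) => u0; first by left.
by rewrite in_fset1U => /orP[/eqP->|]; [right|left].
Qed.

(** The leading monomial of [p] is either that of the remainder or the leading
    monomial of some [q * g], hence a multiple of that of [g]. *)
Lemma exchange_LM_ideal G p u m : remainder p (G `\ p) u ->
  LM_ideal G m -> LM_ideal (exchange G p u) m.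
Proof.
move=> rem_p [f fG [f0 le_m]]; have [fp|fp] := eqVneq f p; last first.
  by apply: (LM_idealS (exchange_sub G p u)); exists f; rewrite // !inE fp.
apply: (LM_ideal_up le_m); rewrite {f}fp in f0 {fG le_m} *.
have [pu|[q [g [gG p_in le_p]]]] := remainder_supp rem_p (LM_msupp f0).
  have u0 : u != 0 by apply: contraTneq pu => ->; rewrite msupp0.
  exists u; first by rewrite /exchange (negPf u0) !inE eqxx.
  split=> //; rewrite (LM_eq pu) ?lepm_refl //; exact: remainder_le rem_p.
have : q * g != 0 by apply: contraTneq p_in => ->; rewrite msupp0.
rewrite mulf_eq0 negb_or => /andP[q0 g0].
apply: (LM_idealS (exchange_sub G p u)); exists g => //; split=> //.
by rewrite (lex_anti (lex_le_LM p_in) le_p) LMM // lem_addl.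
Qed.

Lemma exchange_ideal G p u h : p \in G -> remainder p (G `\ p) u ->
  ideal_gen G h <-> ideal_gen (exchange G p u) h.
Proof.
move=> pG [q [def_p _ _]]; split; apply: ideal_gen_sub => f.
  have [->|fp] := eqVneq f p; last first.
    move=> fG; apply/ideal_gen_mem/(fsubsetP (exchange_sub G p u)).
    by rewrite !inE fp.
  rewrite {3}def_p => _; apply: ideal_genD.
    apply: ideal_gen_sum => g gG.
    exact/ideal_gen_mem/(fsubsetP (exchange_sub G p u)).
  have [->|u0] := eqVneq u 0; first exact: ideal_gen0.
  by apply: ideal_gen_mem; rewrite /exchange (negPf u0) !inE eqxx.
have mem_G g : g \in G `\ p -> ideal_gen G g.
  by rewrite !inE => /andP[_]; apply: ideal_gen_mem.
move=> /exchange_mem[/mem_G //|[-> _]].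
rewrite (_ : u = p + (-1) * \sum_(g <- G `\ p) q g * g).
  apply: ideal_genD; first exact: ideal_gen_mem.
  by apply: ideal_genM; apply: ideal_gen_sum.
by rewrite {1}def_p mulN1r addrC addKr.
Qed.

Lemma interreduces_LM_ideal F G m :
  interreduces F G -> LM_ideal F m -> LM_ideal G m.
Proof.
elim=> [//|G' p u _ IH _ rem_p Fm].
by apply: (exchange_LM_ideal rem_p); apply: IH.
Qed.

Lemma interreduces_ideal F G h :
  interreduces F G -> ideal_gen F h <-> ideal_gen G h.
Proof.
elim=> [//|G' p u _ IH pG' rem_p]; rewrite IH; exact: (exchange_ideal h pG' rem_p).
Qed.

Lemma ideal_gen_LTs F G p : (forall m, LM_ideal F m -> LM_ideal G m) ->
  ideal_gen (LTs F) p -> ideal_gen (LTs G) p.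
Proof.
move=> sFG; apply: ideal_gen_sub => _ /imfsetP[f /= fF ->].
have [->|f0] := eqVneq f 0.
  by rewrite /LT mcoeff0 scale0r; apply: ideal_gen0.
have [|g gG [g0 le_gf]] := sFG (LM f).
  by exists f => //; rewrite lepm_refl.
have [q ->] := pdvd_LT g0 f0 le_gf; apply: ideal_genM; apply: ideal_gen_mem.
exact: in_imfset.
Qed.

(** Where one leading term divides another, the remainder of the second polynomial
    is zero or has a smaller leading monomial: the multiset of leading monomials
    decreases. *)
Lemma interreduced_exists F : exists2 G, interreduces F G &
  {in G &, forall f1 f2, f1 != f2 -> ~ pdvd (LT f1) (LT f2)}.
Proof.
pose R f1 f2 := lex_lt (@LM K r f1) (LM f2).
have wfR : well_founded R := wf_inverse_image _ _ _ _ (@lex_wf r).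
suff H G : interreduces F G -> exists2 G, interreduces F G &
    {in G &, forall f1 f2, f1 != f2 -> ~ pdvd (LT f1) (LT f2)}.
  exact: H (InterRefl F).
elim/(well_founded_induction (fset_below_wf wfR)): G => G IHG FG.
have [[f1 [f2 [f1G f2G neq12 dvd12]]]|irred] := classic (exists f1 f2,
    [/\ f1 \in G, f2 \in G, f1 != f2 & pdvd (LT f1) (LT f2)]); last first.
  by exists G => // f1 f2 f1G f2G neq12 dvd12; apply: irred; exists f1, f2.
have [u rem_u small_u] : exists2 u, remainder f2 (G `\ f2) u &
    u != 0 -> lex_lt (LM u) (LM f2).
  have [f2_0|f2_0] := eqVneq f2 0.
    exists 0; last by rewrite eqxx.
    exists (fun => 0); split=> [|g _|m g]; rewrite ?mul0r ?eqxx ?msupp0 //.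
    by rewrite f2_0 big1 ?addr0 // => g _; rewrite mul0r.
  have [u rem_u] := remainder_exists f2 (G `\ f2); exists u => // u0.
  rewrite lex_lt_neqAle (remainder_le rem_u) ?LM_msupp // andbT.
  case: rem_u => q [_ _ red_u]; apply/eqP => eq_LM.
  have f1G' : f1 \in G `\ f2 by rewrite !inE neq12.
  apply: (red_u _ _ (LM_msupp u0) f1G'); rewrite eq_LM.
  case: dvd12 => d def_f2; exists ((f2@_(LM f2))^-1 *: d).
  by rewrite -scalerAl -def_f2 /LT scalerA mulVf ?LM_coef_neq0 // scale1r.
apply: (IHG (exchange G f2 u)); last exact: InterStep.
exists f2 => // f /exchange_mem[|[-> u0]]; first by left.
by right; apply: small_u.
Qed.

Lemma is_red_exists F : exists G, is_red F G.
Proof.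
have [G FG irred] := interreduced_exists F; exists G; split=> // p.
  by apply: ideal_gen_LTs => m; apply: interreduces_LM_ideal FG.
exact: interreduces_ideal.
Qed.

End Interreduction.

(** * Polynomials in one variable *)

Section UniMorphism.
Variables (K : fieldType) (r : nat) (i : 'I_r).
Implicit Types (f g : {mpoly K[r]}) (m : 'X_{1..r}).

HB.instance Definition _ := GRing.RMorphism.copy (@uni K r i)
  (mmap (polyC \o @mpolyC r K)
        (fun j : 'I_r => if j == i then 'X else ('X_j)%:P)).

Lemma uni_monomial (c : K) m :
  uni i (c *: 'X_[m]) = (c *: 'X_[m - U_(i) *+ m i])%:P * 'X^(m i).
Proof.
rewrite -!mul_mpolyC [LHS]rmorphM polyCM -mulrA; congr (_ * _).
  exact: mmapC.
rewrite /= /uni mmapX /mmap1 (bigD1 i) //= eqxx mulrC; congr (_ * _).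
rewrite [in RHS]mpolyXE_id [in RHS](bigD1 i) //=.
rewrite mnmBE mulmnE mnm1E eqxx mul1n subnn mul1r.
rewrite rmorph_prod; apply: eq_bigr => j /negPf ji.
by rewrite ji mnmBE mulmnE mnm1E eq_sym ji mul0n subn0 rmorphXn.
Qed.

End UniMorphism.

(** Sealed copies of [uni], of its coefficients and of [deg]: a test of whether
    [uni i f] and [uni i g] are convertible, for distinct [f] and [g], would
    unfold the whole construction of multivariate polynomials. *)
HB.lock Definition upoly (K : fieldType) (r : nat) (i : 'I_r)
  (f : {mpoly K[r]}) : {poly {mpoly K[r]}} := uni i f.

HB.lock Definition ucoef (K : fieldType) (r : nat) (i : 'I_r)
  (f : {mpoly K[r]}) (n : nat) : {mpoly K[r]} := (upoly i f)`_n.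

HB.lock Definition udeg (K : fieldType) (r : nat) (i : 'I_r)
  (f : {mpoly K[r]}) : nat := deg i f.

Section UnivariateView.
Variables (K : fieldType) (r : nat) (i : 'I_r).
Implicit Types (f g h a b u : {mpoly K[r]}) (m : 'X_{1..r}).
Local Notation upoly := (@upoly K r i).
Local Notation ucoef := (@ucoef K r i).
Local Notation udeg := (@udeg K r i).

Let mcoeff_add f g m : (f + g)@_m = f@_m + g@_m. Proof. exact: mcoeffD. Qed.

Lemma uniE f : uni i f = upoly f. Proof. by rewrite upoly.unlock. Qed.

Lemma coef_upoly f n : (upoly f)`_n = ucoef f n.
Proof. by rewrite ucoef.unlock. Qed.

Lemma upoly0 : upoly (0 : {mpoly K[r]}) = 0.
Proof. by rewrite -uniE; apply: rmorph0. Qed.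
Lemma upolyD f g : upoly (f + g) = upoly f + upoly g.
Proof. by rewrite -!uniE; apply: rmorphD. Qed.
Lemma upolyB f g : upoly (f - g) = upoly f - upoly g.
Proof. by rewrite -!uniE; apply: rmorphB. Qed.
Lemma upolyM f g : upoly (f * g) = upoly f * upoly g.
Proof. by rewrite -!uniE; apply: rmorphM. Qed.
Lemma upolyXn f n : upoly (f ^+ n) = upoly f ^+ n.
Proof. by rewrite -!uniE; apply: rmorphXn. Qed.

Lemma ucoef0 n : ucoef (0 : {mpoly K[r]}) n = 0.
Proof. by rewrite -coef_upoly upoly0 coef0. Qed.
Lemma ucoefD f g n : ucoef (f + g) n = ucoef f n + ucoef g n.
Proof. by rewrite -!coef_upoly upolyD coefD. Qed.

Lemma mnm_shift m n : (m + U_(i) *+ n)%MM i = (m i + n)%N.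
Proof. by rewrite mnmDE mulmnE mnm1E eqxx mul1n. Qed.

Lemma mnm_unshift m : (m - U_(i) *+ m i)%MM i = 0%N.
Proof. by rewrite mnmBE mulmnE mnm1E eqxx mul1n subnn. Qed.

Lemma mnm_le_var m : (U_(i) *+ m i <= m)%MM.
Proof.
apply/mnm_lepP => j; rewrite mulmnE mnm1E; case: eqP => [->|_].
  by rewrite mul1n.
by rewrite mul0n.
Qed.

(** With this description of the coefficients of [upoly], all its properties
    reduce to statements about supports. *)
Lemma mcoeff_ucoef f n m :
  (ucoef f n)@_m = if m i == 0%N then f@_(m + U_(i) *+ n) else 0.
Proof.
pose P g := (ucoef g n)@_m = if m i == 0%N then g@_(m + U_(i) *+ n) else 0.
have PD g h : P g -> P h -> P (g + h).
  rewrite /P ucoefD !mcoeff_add.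
  by case: ifP => _ -> ->; rewrite ?addr0.
rewrite -/(P f); elim/mpolyind: f => [|c m0 f _ _]; last first.
  apply: PD; rewrite /P -coef_upoly -uniE uni_monomial coefCM coefXn.
  rewrite mulr_natr mcoeffMn !mcoeffZ !mcoeffX.
  transitivity (c * ((n == m0 i) && ((m0 - U_(i) *+ m0 i)%MM == m))%:R).
    by case: (n == m0 i); rewrite ?mulr1n // mulr0n mulr0.
  have -> : (n == m0 i) && ((m0 - U_(i) *+ m0 i)%MM == m) =
            (m i == 0%N) && (m0 == (m + U_(i) *+ n)%MM).
    apply/andP/andP => [[/eqP-> /eqP<-]|[/eqP mi /eqP->]].
      by rewrite mnm_unshift submK ?mnm_le_var // !eqxx.
    by rewrite mnm_shift mi add0n addmK !eqxx.
  by case: (m i == 0%N) => //=; rewrite mulr0.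
by rewrite /P ucoef0 !mcoeff0; case: ifP.
Qed.

Lemma mcoeff_split f m : f@_m = (ucoef f (m i))@_(m - U_(i) *+ m i).
Proof.
by rewrite mcoeff_ucoef mnm_unshift eqxx submK ?mnm_le_var.
Qed.

Lemma ucoef_inj f g : (forall n, ucoef f n = ucoef g n) -> f = g.
Proof.
move=> eq_fg; apply/mpolyP => m.
by rewrite (mcoeff_split f) eq_fg -mcoeff_split.
Qed.

Lemma upoly_inj : injective upoly.
Proof.
by move=> f g eq_fg; apply: ucoef_inj => n; rewrite -!coef_upoly eq_fg.
Qed.

Lemma upoly_eq0 f : (upoly f == 0) = (f == 0).
Proof. by rewrite -upoly0 (inj_eq upoly_inj). Qed.

Lemma msupp_ucoef f n m :
  (m \in msupp (ucoef f n)) = (m i == 0%N) && ((m + U_(i) *+ n)%MM \in msupp f).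
Proof.
rewrite mcoeff_msupp mcoeff_ucoef; case: (m i == 0%N); last by rewrite eqxx.
by rewrite mcoeff_msupp.
Qed.

Lemma udegE f : udeg f = (size (upoly f)).-1.
Proof. by rewrite udeg.unlock /deg uniE. Qed.

Lemma degE f : deg i f = udeg f.
Proof. by rewrite udeg.unlock. Qed.

Lemma LCE f : LC i f = ucoef f (udeg f).
Proof. by rewrite /LC lead_coefE uniE coef_upoly udegE. Qed.

Lemma ucoef_udeg_neq0 f : f != 0 -> ucoef f (udeg f) != 0.
Proof. by rewrite -LCE /LC uniE lead_coef_eq0 upoly_eq0. Qed.

Lemma size_upoly f : f != 0 -> size (upoly f) = (udeg f).+1.
Proof. by rewrite -upoly_eq0 udegE => f0; rewrite prednK // size_poly_gt0. Qed.

Lemma udeg_leP f d :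
  reflect {in msupp f, forall m, (m i <= d)%N} (udeg f <= d)%N.
Proof.
rewrite udegE -[(_ <= d)%N]ltnS.
have -> : ((size (upoly f)).-1 < d.+1)%N = (size (upoly f) <= d.+1)%N.
  by case: (size _).
apply: (iffP (leq_sizeP _ _)) => [coef0 m|le_d n dn].
  rewrite leqNgt mcoeff_msupp mcoeff_split; apply: contraNN => /coef0.
  by rewrite coef_upoly => ->; rewrite mcoeff0.
rewrite coef_upoly; apply/mpolyP => m; rewrite mcoeff0; apply/eqP.
rewrite mcoeff_eq0 msupp_ucoef; apply/negP => /andP[_ /le_d].
by rewrite mnm_shift leqNgt ltn_addl.
Qed.

Lemma udeg_msupp f : f != 0 -> exists2 m, m \in msupp f & m i = udeg f.
Proof.
move=> /ucoef_udeg_neq0 /LM_msupp; rewrite msupp_ucoef => /andP[/eqP mi m_in].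
by eexists; first exact: m_in; rewrite mnm_shift mi.
Qed.

(** If no earlier variable occurs, the lexicographic order compares exponents of
    this variable first. *)
Lemma LM_udeg f : only_vars_from i f -> LM f i = udeg f.
Proof.
move=> f_vars; have [->|f0] := eqVneq f 0.
  by rewrite udegE upoly0 size_poly0 /LM msupp0 big_nil mnm0E.
apply/eqP; rewrite eqn_leq; apply/andP; split.
  by have /udeg_leP := leqnn (udeg f); apply; apply: LM_msupp.
have [m m_in <-] := udeg_msupp f0.
by have [_ ->] := lex_le_vars (lex_le_LM m_in) (f_vars _ (LM_msupp f0)).
Qed.

(** * Polynomials free of a variable *)

Definition varfree f := udeg f == 0%N.

Lemma varfreeP f : reflect {in msupp f, forall m, m i = 0%N} (varfree f).
Proof.
rewrite /varfree -leqn0; apply: (iffP (udeg_leP _ _)) => H m /H; rewrite ?leqn0.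
  by move/eqP.
by move=> ->.
Qed.

Lemma varfree_deg f : varfree f <-> deg i f = 0%N.
Proof. by rewrite /varfree degE; split=> /eqP. Qed.

Lemma varfree_ucoef f n : varfree (ucoef f n).
Proof. by apply/varfreeP => m; rewrite msupp_ucoef => /andP[/eqP]. Qed.

Lemma upoly_free f : varfree f -> upoly f = f%:P.
Proof.
move=> f_free; rewrite [upoly f]size1_polyC.
  congr (_%:P); apply/mpolyP => m; rewrite coef_upoly mcoeff_ucoef addm0.
  case: eqP => // /eqP mi; apply/esym/eqP; rewrite mcoeff_eq0.
  by apply: contra mi => /(varfreeP _ f_free)->.
have [->|f0] := eqVneq f 0; first by rewrite upoly0 size_poly0.
by rewrite size_upoly // (eqP f_free).
Qed.

Lemma upoly_var : upoly 'X_i = 'X.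
Proof.
rewrite -[X in upoly X]scale1r -uniE uni_monomial mnm1E eqxx scale1r.
by rewrite mulm1n (_ : (U_(i) - U_(i))%MM = 0%MM) ?mpolyX0 ?mul1r //;
  apply/mnmP => j; rewrite mnmBE subnn mnm0E.
Qed.

(** The image of [upoly] consists of the polynomials whose coefficients are free
    of the variable. *)
Lemma upoly_horner (A : {poly {mpoly K[r]}}) :
  (forall n, varfree A`_n) -> upoly A.['X_i] = A.
Proof.
move=> freeA; rewrite horner_coef.
rewrite (big_morph upoly upolyD upoly0) -[RHS]coefK poly_def.
apply: eq_bigr => n _.
by rewrite upolyM upolyXn upoly_var upoly_free ?mul_polyC.
Qed.

(** Substitution of zero for the variable: a ring morphism that fixes exactly the
    polynomials free of the variable. *)
Definition erase f := ucoef f 0.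

Lemma erase_zmod_morphism : zmod_morphism erase.
Proof. by move=> f g; rewrite /erase -!coef_upoly upolyB coefB. Qed.

Lemma erase_monoid_morphism : GRing.monoid_morphism erase.
Proof.
split=> [|f g]; rewrite /erase -!coef_upoly; last by rewrite upolyM coef0M.
by rewrite -uniE rmorph1 coef1.
Qed.

HB.instance Definition _ :=
  GRing.isZmodMorphism.Build _ _ erase erase_zmod_morphism.
HB.instance Definition _ :=
  GRing.isMonoidMorphism.Build _ _ erase erase_monoid_morphism.

Lemma eraseM f g : erase (f * g) = erase f * erase g.
Proof. exact: rmorphM. Qed.

Lemma eraseXn f n : erase (f ^+ n) = erase f ^+ n.
Proof. exact: rmorphXn. Qed.

Lemma varfree_erase f : varfree (erase f). Proof. exact: varfree_ucoef. Qed.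

Lemma erase_free f : varfree f -> erase f = f.
Proof. by rewrite /erase -coef_upoly => /upoly_free->; rewrite coefC. Qed.

Lemma msupp_erase f : {subset msupp (erase f) <= msupp f}.
Proof. by move=> m; rewrite msupp_ucoef mulm0n addm0 => /andP[]. Qed.

End UnivariateView.

(** * Division with cleared denominators *)

Section PseudoDivision.
Variables (K : fieldType) (r : nat) (i : 'I_r).
Implicit Types (f g h a b u : {mpoly K[r]}) (m : 'X_{1..r}).
Local Notation upoly := (@upoly K r i).

Lemma varfree_LC h : varfree i (LC i h).
Proof. by rewrite LCE; apply: varfree_ucoef. Qed.

Lemma upoly_LC_exp h j : upoly (LC i h ^+ j) = (LC i h ^+ j)%:P.
Proof. by rewrite upolyXn (upoly_free (varfree_LC h)) [RHS]rmorphXn. Qed.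

Lemma erase_LC_exp h j : erase i (LC i h ^+ j) = LC i h ^+ j.
Proof. by rewrite eraseXn (erase_free (varfree_LC h)). Qed.

(** Pseudo-division of univariate polynomials may give coefficients that involve
    the variable; [erase] removes it, and fixes [f], [h] and [LC h]. *)
Lemma pseudo_division f h : h != 0 -> exists n a u,
  LC i h ^+ n * f = a * h + u /\ (size (upoly u) < size (upoly h))%N.
Proof.
move=> h0; have [A [U [n [def_f ltU]]]] : exists A U n,
    (LC i h ^+ n) *: upoly f = A * upoly h + U /\ (size U < size (upoly h))%N.
  exists (upoly f %/ upoly h), (upoly f %% upoly h).
  exists (scalp (upoly f) (upoly h)).
  rewrite ltn_modpN0 ?upoly_eq0 //; split=> //.
  by rewrite -Pdiv.Idomain.divp_eq /LC uniE.
pose eraseP : {poly {mpoly K[r]}} -> {poly {mpoly K[r]}} := map_poly (erase i).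
have erase_upoly g : eraseP (upoly g) = upoly g.
  apply/polyP => k; rewrite coef_map coef_upoly.
  by apply: erase_free; apply: varfree_ucoef.
have free_eraseP B k : varfree i (eraseP B)`_k.
  by rewrite coef_map; apply: varfree_erase.
exists n, (eraseP A).['X_i], (eraseP U).['X_i]; split; last first.
  by rewrite upoly_horner //; apply: leq_ltn_trans (size_poly _ _) ltU.
apply: (@upoly_inj _ _ i); rewrite upolyM upolyD upolyM !upoly_horner //.
rewrite upoly_LC_exp -{1}erase_upoly -{1}(erase_upoly h) /eraseP.
rewrite -!rmorphM -rmorphD /= -def_f -mul_polyC rmorphM /=.
by rewrite map_polyC /= erase_LC_exp.
Qed.

Let frac_upoly f : {poly {fraction {mpoly K[r]}}} :=
  map_poly (@FracField.tofrac {mpoly K[r]}) (upoly f).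

Let tofrac_inj : injective (@FracField.tofrac {mpoly K[r]}).
Proof. by move=> f g /eqP; rewrite tofrac_eq => /eqP. Qed.

(** A cleared division is a pseudo-division, since quotient and remainder over
    the field of fractions are unique. *)
Lemma cleared_divisionP f h j a u : h != 0 ->
  cleared_division i f h j a u <->
  LC i h ^+ j * f = a * h + u /\ (size (upoly u) < size (upoly h))%N.
Proof.
move=> h0; rewrite /cleared_division /univF !uniE.
rewrite -/(frac_upoly f) -/(frac_upoly h) -/(frac_upoly a) -/(frac_upoly u).
have size_frac g : size (frac_upoly g) = size (upoly g).
  by rewrite size_map_inj_poly ?tofrac0.
have fracE b g : map_poly (@FracField.tofrac {mpoly K[r]}) (b *: upoly g) =
    FracField.tofrac b *: frac_upoly g.
  by rewrite /frac_upoly map_polyZ.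
have eqE : LC i h ^+ j * f = a * h + u <->
    FracField.tofrac (LC i h ^+ j) *: frac_upoly f =
    frac_upoly a * frac_upoly h + frac_upoly u.
  rewrite -fracE /frac_upoly -rmorphM -rmorphD /=.
  rewrite -upolyM -upolyD -mul_polyC -upoly_LC_exp -upolyM.
  by split=> [->//|/(map_inj_poly tofrac_inj (tofrac0 _))/upoly_inj].
rewrite eqE -!size_frac.
have b0 : FracField.tofrac (LC i h ^+ j) != 0.
  by rewrite tofrac_eq0 expf_neq0 // LCE ucoef_udeg_neq0.
have H0 : frac_upoly h != 0 by rewrite -size_poly_gt0 size_frac size_upoly.
move: {eqE} (FracField.tofrac _) b0 (frac_upoly f) (frac_upoly h) H0.
move: (frac_upoly a) (frac_upoly u) => A U b b0 F H H0.
split=> [[-> ->]|[eqF ltU]].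
  rewrite -scalerAl -scalerDr -divp_eq; split=> //.
  by rewrite size_scale // ltn_modp.
have {eqF} defF : F = (b^-1 *: A) * H + b^-1 *: U.
  by rewrite -scalerAl -scalerDr -eqF scalerA mulVf // scale1r.
rewrite -(divpP defF) -?(modpP defF) ?size_scale ?invr_eq0 //.
by rewrite !scalerA mulfV // !scale1r.
Qed.

Lemma clears_exists f h : h != 0 -> exists2 j, (deg i h < j)%N & clears i f h j.
Proof.
move=> h0; have [n [a [u [def_f ltu]]]] := pseudo_division f h0.
set b := LC i h in def_f; set d := (deg i h).+1.
exists (d + n)%N; first exact: leq_addr.
exists (b ^+ d * a), (b ^+ d * u); apply/cleared_divisionP => //; split.
  by rewrite exprD -mulrA def_f mulrDr mulrA.
rewrite upolyM upoly_LC_exp mul_polyC; apply: leq_ltn_trans ltu.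
exact: size_scale_leq.
Qed.

Lemma exponent_exists f h : h != 0 -> exists j, exponent i f h j.
Proof.
move=> h0; have [j hj clears_j] := clears_exists f h0.
elim/ltn_ind: j hj clears_j => j IHj hj clears_j.
have [[j' [/andP[hj' j'j] clears_j']]|jmin] :=
    classic (exists j', (deg i h < j' < j)%N /\ clears i f h j').
  exact: (IHj j').
by exists j; split=> // j' j'_in clears_j'; apply: jmin; exists j'.
Qed.

End PseudoDivision.

(** * Variables and degrees along the algorithm *)

Section CurrentVariable.
Variables (K : fieldType) (r : nat).
Implicit Types (p f g h a b u : {mpoly K[r]}) (F G : {fset {mpoly K[r]}}).
Implicit Types (m : 'X_{1..r}) (k : nat) (i l : 'I_r).

Lemma only_vars_fromP k f :
  only_vars_from k f <-> forall i, (i < k)%N -> deg i f = 0%N.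
Proof.
split=> [f_vars i ik | f_deg m m_in i ik].
  by apply/varfree_deg/varfreeP => m m_in; apply: f_vars.
by have /varfree_deg/varfreeP := f_deg i ik; apply.
Qed.

Lemma only_vars_from_sub k f g :
  {subset msupp f <= msupp g} -> only_vars_from k g -> only_vars_from k f.
Proof. by move=> sub g_vars m /sub; apply: g_vars. Qed.

Lemma only_vars_fromW k k' f :
  (k' <= k)%N -> only_vars_from k f -> only_vars_from k' f.
Proof. by move=> le_k f_vars m m_in i /leq_trans/(_ le_k); apply: f_vars. Qed.

Lemma only_vars_from_ucoef i f n :
  only_vars_from i f -> only_vars_from i.+1 (ucoef i f n).
Proof.
move=> f_vars m; rewrite msupp_ucoef => /andP[/eqP mi m_in] j.
rewrite ltnS leq_eqVlt => /orP[/eqP/val_inj-> //|ji].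
by have /eqP := f_vars _ m_in j ji; rewrite mnmDE addn_eq0 => /andP[/eqP].
Qed.

Lemma LM_vars k p i : only_vars_from k p -> (i < k)%N -> LM p i = 0%N.
Proof.
move=> p_vars ik; have [->|p0] := eqVneq p 0; last first.
  exact: p_vars (LM_msupp p0) _ _.
by rewrite /LM msupp0 big_nil mnm0E.
Qed.

Lemma remainder_vars k p G u :
  remainder p G u -> only_vars_from k p -> only_vars_from k u.
Proof.
move=> rem_u p_vars m /(remainder_le rem_u) le_m.
by have [] := lex_le_vars le_m (fun i => @LM_vars k p i p_vars).
Qed.

(** The current variable is the leading one among those of [p], so smaller
    monomials have no larger degree in it. *)
Lemma remainder_udeg i p G u :
  remainder p G u -> only_vars_from i p -> (udeg i u <= udeg i p)%N.
Proof.
move=> rem_u p_vars; apply/udeg_leP => m /(remainder_le rem_u) le_m.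
have [_ le_i] := lex_le_vars le_m (fun l => @LM_vars i p l p_vars).
by rewrite -LM_udeg ?le_i.
Qed.

Lemma interreduces_vars k F G : interreduces F G ->
  {in F, forall f, only_vars_from k f} -> {in G, forall f, only_vars_from k f}.
Proof.
elim=> [//|G' p u _ IH pG' rem_u] F_vars f /exchange_mem[|[-> _]].
  by rewrite !inE => /andP[_]; apply: IH.
by apply: remainder_vars rem_u _; apply: IH.
Qed.

Definition sumdeg i F : nat := (\sum_(f <- F) udeg i f)%N.

Lemma sumdegD1 i F f : f \in F -> sumdeg i F = (udeg i f + sumdeg i (F `\ f))%N.
Proof. exact: big_fsetD1. Qed.

Lemma sumdeg_fset1U i F f : (sumdeg i (f |` F) <= udeg i f + sumdeg i F)%N.
Proof.
have [fF|fF] := boolP (f \in F); last by rewrite /sumdeg big_fsetU1.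
by rewrite mem_fset1U // leq_addl.
Qed.

Lemma interreduces_sumdeg i F G : interreduces F G ->
  {in F, forall f, only_vars_from i f} -> (sumdeg i G <= sumdeg i F)%N.
Proof.
move=> FG F_vars; elim: FG => [//|G' p u FG' IH pG' rem_u].
apply: leq_trans IH; rewrite (sumdegD1 i pG') -/(exchange G' p u) /exchange.
case: ifP => _; first exact: leq_addl.
apply: leq_trans (sumdeg_fset1U _ _ _) _; rewrite leq_add2r.
exact: remainder_udeg rem_u (interreduces_vars FG' F_vars pG').
Qed.

Lemma size_upoly_sub i f g : {subset msupp f <= msupp g} ->
  (size (upoly i f) <= size (upoly i g))%N.
Proof.
move=> sub; have [->|f0] := eqVneq f 0; first by rewrite upoly0 size_poly0.
have g0 : g != 0.
  by have := sub _ (LM_msupp f0); apply: contraTneq => ->; rewrite msupp0.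
rewrite !size_upoly // ltnS; apply/udeg_leP => m /sub m_in.
by have /udeg_leP := leqnn (udeg i g); apply.
Qed.

(** Substituting zero for a variable foreign to [f] and [h] in the division of [f]
    by [h] gives another such division, so does not change the remainder. *)
Lemma division_free i l f h j a u : h != 0 ->
  LC i h ^+ j * f = a * h + u -> (size (upoly i u) < size (upoly i h))%N ->
  varfree l f -> varfree l h -> varfree l u.
Proof.
move=> h0 def_u ltu f_free h_free.
have b_free : varfree l (LC i h).
  apply/varfreeP => m; rewrite LCE msupp_ucoef => /andP[_].
  move=> /(varfreeP _ _ h_free)/eqP; by rewrite mnmDE addn_eq0 => /andP[/eqP].
have := congr1 (erase l) def_u.
rewrite eraseM eraseXn (erase_free b_free) (erase_free f_free) def_u.
have -> : erase l (a * h + u) = erase l a * h + erase l u.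
  by rewrite [LHS]rmorphD /= eraseM (erase_free h_free).
move=> eq_au.
have {}eq_au : (a - erase l a) * h = erase l u - u.
  by rewrite mulrBl -[a * h](addrK u) eq_au [_ + erase l u]addrC addrAC addrK.
suff eq_u : erase l u - u = 0.
  by move/eqP: eq_u; rewrite subr_eq0 => /eqP <-; apply: varfree_erase.
rewrite -eq_au; apply/eqP; rewrite mulf_eq0 (negPf h0) orbF.
apply: contraTT isT => a0.
have : (size (upoly i ((a - erase l a) * h)) < size (upoly i h))%N.
  rewrite eq_au upolyB (leq_ltn_trans (size_polyD _ _)) //.
  rewrite size_polyN gtn_max ltu.
  by rewrite andbT (leq_ltn_trans (size_upoly_sub i (@msupp_erase _ _ l u))).
rewrite upolyM size_mul ?upoly_eq0 // !size_upoly // addSn /= ltnNge.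
by rewrite leq_addl.
Qed.

Lemma udeg_lt_size i u h : (0 < udeg i h)%N ->
  (size (upoly i u) < size (upoly i h))%N -> (udeg i u < udeg i h)%N.
Proof.
by rewrite !udegE; case: (size _) => [|[|n]]; case: (size _) => [|[|n']].
Qed.

Lemma LM_LC i h : only_vars_from i h -> h != 0 ->
  LM h = (LM (LC i h) + U_(i) *+ udeg i h)%MM.
Proof.
move=> h_vars h0; rewrite LCE; set b := ucoef _ _ _.
have : LM b \in msupp b by apply/LM_msupp/ucoef_udeg_neq0.
rewrite msupp_ucoef => /andP[_ b_in]; apply: lex_anti; last exact: lex_le_LM.
have LM_i := LM_udeg h_vars.
rewrite -[X in lex_le X](submK (mnm_le_var i (LM h))) LM_i lex_leD2r.
apply: lex_le_LM; rewrite msupp_ucoef -LM_i mnm_unshift eqxx /=.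
by rewrite submK ?mnm_le_var ?LM_msupp.
Qed.

End CurrentVariable.

(** * Truncations *)

Section Truncation.
Variables (K : fieldType) (r : nat) (i : 'I_r).
Implicit Types (f c : {mpoly K[r]}).

Lemma upoly_truncation f j :
  upoly i (truncation i f j) = \poly_(l < j.+1) ucoef i f l.
Proof.
rewrite /truncation (big_morph _ (@upolyD _ _ i) (@upoly0 _ _ i)) poly_def.
apply: eq_bigr => l _; rewrite uniE coef_upoly upolyM upolyXn upoly_var.
by rewrite upoly_free ?varfree_ucoef // mul_polyC.
Qed.

Lemma ucoef_truncation f j l :
  ucoef i (truncation i f j) l = if (l <= j)%N then ucoef i f l else 0.
Proof. by rewrite -coef_upoly upoly_truncation coef_poly. Qed.

Lemma ucoef_gt_udeg f n : (udeg i f < n)%N -> ucoef i f n = 0.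
Proof.
move=> dn; have [->|f0] := eqVneq f 0; first exact: ucoef0.
by rewrite -coef_upoly nth_default // size_upoly.
Qed.

Lemma truncation_id f j : (udeg i f <= j)%N -> truncation i f j = f.
Proof.
move=> dj; apply: (@ucoef_inj _ _ i) => n; rewrite ucoef_truncation.
by case: leqP => // jn; rewrite ucoef_gt_udeg // (leq_ltn_trans dj).
Qed.

Lemma msupp_truncation f j : {subset msupp (truncation i f j) <= msupp f}.
Proof.
move=> m; rewrite !mcoeff_msupp (mcoeff_split i) ucoef_truncation.
by rewrite (mcoeff_split i f); case: ifP => // _; rewrite mcoeff0 eqxx.
Qed.

Lemma udeg_truncation f j : ucoef i f j != 0 -> udeg i (truncation i f j) = j.
Proof. by move=> fj; rewrite udegE upoly_truncation size_poly_eq. Qed.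

Lemma coefs_fromP f j c : f != 0 ->
  reflect (exists2 l, (j <= l <= udeg i f)%N & c = ucoef i f l)
          (c \in coefs_from i f j).
Proof.
move=> f0; rewrite /coefs_from !inE uniE.
apply: (iffP (nthP 0)) => [[l]|[l /andP[jl ld ->]]].
  rewrite size_drop size_upoly // nth_drop coef_upoly => ld <-.
  by exists (j + l)%N => //; rewrite leq_addr -ltnS -ltn_subRL.
exists (l - j)%N; last by rewrite nth_drop subnKC // coef_upoly.
by rewrite size_drop size_upoly // ltn_sub2r // ltnS (leq_trans jl).
Qed.

End Truncation.

(** * Solutions *)

(** Sealed for the same reason as [upoly]. *)
HB.lock Definition value (K : fieldType) (L : closedFieldType)
    (iota : {rmorphism K -> L}) (r : nat) (x : 'I_r -> L)
    (f : {mpoly K[r]}) : L :=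
  (map_mpoly iota f).@[x].

Section SolutionSets.
Variables (K : fieldType) (L : closedFieldType) (iota : {rmorphism K -> L}).
Variables (r : nat) (x : 'I_r -> L).
Implicit Types (f g h p : {mpoly K[r]}) (s n : system K r).
Implicit Types (F G : {fset {mpoly K[r]}}) (S T N : {fset system K r}).

Local Notation ev := (@value K L iota r x).

Lemma evE f : (map_mpoly iota f).@[x] = ev f.
Proof. by rewrite value.unlock. Qed.

Lemma evD f g : ev (f + g) = ev f + ev g.
Proof. by rewrite -!evE rmorphD /= mevalD. Qed.

Lemma evM f g : ev (f * g) = ev f * ev g.
Proof. by rewrite -!evE rmorphM /= mevalM. Qed.

Lemma ev0 : ev 0 = 0.
Proof. by rewrite -!evE rmorph0 meval0. Qed.

Lemma evXn f (n : nat) : ev (f ^+ n) = ev f ^+ n.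
Proof. by rewrite -!evE rmorphXn /= rmorphXn. Qed.

Lemma ev_truncation (i : 'I_r) f j :
  ev (truncation i f j) = \sum_(l < j.+1) ev (ucoef i f l) * ev 'X_i ^+ l.
Proof.
rewrite /truncation (big_morph _ evD ev0); apply: eq_bigr => l _.
by rewrite evM evXn uniE coef_upoly.
Qed.

Lemma ideal_gen_ev F p :
  {in F, forall f, ev f = 0} -> ideal_gen F p -> ev p = 0.
Proof.
move=> F0 [q ->]; rewrite (big_morph _ evD ev0) big1_seq // => f /= fF.
by rewrite evM (F0 f fF) mulr0.
Qed.

Definition solves s : Prop :=
  {in square s `|` tri s, forall f, ev f = 0} /\ ev (ineq s) <> 0.

Lemma solvesE s : solves s <->
  [/\ {in square s, forall f, ev f = 0}, {in tri s, forall f, ev f = 0} &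
      ev (ineq s) <> 0].
Proof.
split=> [[eqs neq]|[sq0 tri0 neq]]; split=> //.
- by move=> f fs; apply: eqs; rewrite inE fs.
- by move=> f fs; apply: eqs; rewrite inE fs orbT.
- by move=> f; rewrite inE => /orP[fs|fs]; [exact: sq0 | exact: tri0].
Qed.

Lemma solves_red s F :
  is_red (square s) F -> solves s <-> solves (with_square s F).
Proof.
case=> _ _ _ eq_ideal; rewrite !solvesE /=.
split=> -[sq0 tri0 neq]; split=> // f fF;
  apply: (ideal_gen_ev sq0); apply/eq_ideal; exact: ideal_gen_mem.
Qed.

(** Where [LC h] does not vanish, [f] and its pseudo-remainder [u] by [h] vanish
    together modulo [h]; otherwise [LC h] may be added to the equations. *)
Lemma solves_divide (i : 'I_r) s f h j a u :
  selected_pair i (square s) f h -> cleared_division i f h j a u ->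
  solves s <->
  solves (System (u |` (square s `\ f)) (tri s) (lvl s) (LC i h * ineq s)) \/
  solves (System (LC i h |` square s) (tri s) (lvl s) (ineq s)).
Proof.
case=> fs hs hf deg_h _ /cleared_divisionP[].
  by apply: contraTneq deg_h => ->; rewrite degE udegE upoly0 size_poly0.
move=> /(congr1 (fun p => ev p)); rewrite evD !evM evXn => def_u _.
rewrite !solvesE /= evM; split=> [[sq0 tri0 neq]|].
  have [b0|b0] := eqVneq (ev (LC i h)) 0; [right|left]; split=> //.
  - by move=> p; rewrite in_fset1U => /orP[/eqP->|/sq0].
  - move=> p; rewrite !inE => /orP[/eqP->|/andP[_ /sq0 //]].
    by move: def_u; rewrite (sq0 f fs) (sq0 h hs) !mulr0 add0r.
  - by move/eqP; rewrite mulf_eq0 (negPf b0) => /eqP.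
case=> -[sq0 tri0 neq]; split=> //; last first.
- by move=> p ps; apply: sq0; rewrite inE ps orbT.
- by move=> g0; apply: neq; rewrite g0 mulr0.
have b0 : ev (LC i h) != 0 by apply/eqP => b0; apply: neq; rewrite b0 mul0r.
move=> p ps; have [->|pf] := eqVneq p f; last first.
  by apply: sq0; rewrite !inE pf ps orbT.
apply/eqP; have := esym def_u; rewrite (sq0 u) ?inE ?eqxx // addr0.
rewrite (sq0 h) ?inE ?hs ?hf ?orbT // mulr0 => /esym/eqP.
by rewrite mulf_eq0 expf_eq0 (negPf b0) andbF.
Qed.

(** At a zero of [f], either all coefficients of [f] vanish, or the last one that
    does not is the leading coefficient of a truncation which vanishes as well
    and hence is not constant. *)
Lemma solves_split (i : 'I_r) s f : f \in square s -> (0 < deg i f)%N ->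
  solves s <-> exists2 n, n \in split_off i s f & solves n.
Proof.
rewrite degE => fs deg_f; have f0 : f != 0.
  by apply: contraTneq deg_f => ->; rewrite udegE upoly0 size_poly0.
have def_f j : (forall l, (j < l <= udeg i f)%N -> ev (ucoef i f l) = 0) ->
    (j <= udeg i f)%N -> ev f = ev (truncation i f j).
  move=> fl0 jd; rewrite -[in LHS](truncation_id (leqnn (udeg i f))).
  rewrite !ev_truncation.
  rewrite [RHS](big_ord_widen (udeg i f).+1
    (fun l => ev (ucoef i f l) * ev 'X_i ^+ l)) //.
  rewrite [RHS]big_mkcond; apply: eq_bigr => l _; case: ifPn => //.
  rewrite ltnS -ltnNge => jl.
  by rewrite fl0 ?mul0r // jl -ltnS ltn_ord.
rewrite /split_off; set F := square s `\ f; split.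
  move=> /solvesE[sq0 tri0 neq].
  have F0 : {in F, forall p, ev p = 0}.
    by move=> p; rewrite inE => /andP[_ /sq0].
  have [fl0|] := classic (forall l, (l <= udeg i f)%N -> ev (ucoef i f l) = 0).
    exists (System (F `|` coefs_from i f 0) (tri s) (lvl s).+1 (ineq s)).
      exact: fset1U1.
    apply/solvesE; split=> //= p; rewrite inE => /orP[/F0 //|].
    by move=> /(coefs_fromP _ _ _ f0)[l /andP[_ /fl0 fl] ->].
  move=> not_all; have [j jd [fj fl0]] : exists2 j, (j <= udeg i f)%N &
      ev (ucoef i f j) != 0 /\
      forall l, (j < l <= udeg i f)%N -> ev (ucoef i f l) = 0.
    have ex_j : exists j, (j <= udeg i f)%N && (ev (ucoef i f j) != 0).
      apply: NNPP => none; apply: not_all => l ld; apply/eqP/negPn/negP => fl.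
      by apply: none; exists l; rewrite ld.
    have [|j /andP[jd fj] jmax] := ex_maxnP ex_j (m := udeg i f).
      by move=> j /andP[].
    exists j => //; split=> // l /andP[jl ld]; apply/eqP/negPn/negP => fl.
    by have := jmax l; rewrite ld fl leqNgt jl => /(_ isT).
  have evf : ev (truncation i f j) = 0 by rewrite -def_f // sq0.
  have j_gt0 : (0 < j)%N.
    rewrite lt0n; apply: contraNneq fj => j0; move: evf.
    rewrite j0 ev_truncation; by rewrite big_ord1 expr0 mulr1 => ->.
  have pj : ucoef i f j != 0 by apply: contraNneq fj => ->; rewrite ev0.
  exists (System (F `|` coefs_from i f j.+1) (truncation i f j |` tri s)
                 (lvl s).+1 (ineq s * ucoef i f j)).
    rewrite in_fset1U; apply/orP; right; apply/imfsetP; exists j => /=.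
      rewrite mem_filter uniE coef_upoly pj mem_iota j_gt0.
      by rewrite degE add1n ltnS jd.
    by rewrite uniE coef_upoly.
  apply/solvesE; split=> /= [p|p|].
  - rewrite inE => /orP[/F0 //|/(coefs_fromP _ _ _ f0)[l jl ->]]; exact: fl0.
  - by rewrite in_fset1U => /orP[/eqP->|/tri0].
  - by rewrite evM => /eqP; rewrite mulf_eq0 (negPf fj) orbF => /eqP.
case=> n; rewrite in_fset1U => n_in /solvesE[sq0 tri0 neq].
apply/solvesE; suff [evf sF stri snz] : [/\ ev f = 0, {subset F <= square n},
    {subset tri s <= tri n} & (ev (ineq s) = 0 -> ev (ineq n) = 0)].
  split=> [p ps|p /stri/tri0 //|/snz //]; have [->//|pf] := eqVneq p f.
  by apply/sq0/sF; rewrite !inE pf.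
case/orP: n_in => [/eqP n_def|/imfsetP[j /=]].
  rewrite n_def /= in sq0 *; split=> // [|p pF]; last by rewrite inE pF.
  rewrite (def_f 0%N) // => [|l ld].
    rewrite ev_truncation big_ord1 sq0 ?mul0r // inE.
    by apply/orP; right; apply/coefs_fromP => //; exists 0%N.
  apply: sq0; rewrite inE; apply/orP; right; apply/coefs_fromP => //.
  by exists l => //; case/andP: ld.
rewrite mem_filter mem_iota degE add1n ltnS => /and3P[_ _ jd] n_def.
rewrite n_def /= in sq0 tri0 *; split.
- rewrite (def_f j) // => [|l jl]; first by apply: tri0; rewrite in_fset1U eqxx.
  apply: sq0; rewrite inE; apply/orP; right; apply/coefs_fromP => //.
  by exists l.
- by move=> p pF; rewrite inE pF.
- by move=> p ps; rewrite in_fset1U ps orbT.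
- by rewrite evM => ->; rewrite mul0r.
Qed.

Lemma solves_replacement s N : replacement s N ->
  solves s <-> exists2 n, n \in N & solves n.
Proof.
case=> [i f h j a u _ sel _ cleared|i f _ fs deg_f _|i _ _]; last 1 first.
- split=> [s_sol|[n]]; last by rewrite in_fset1 => /eqP->.
  by eexists; [exact: fset11 | exact: s_sol].
- rewrite (solves_divide sel cleared); split=> [[n_sol|n_sol]|[n]].
  + by eexists; [exact: fset21 | exact: n_sol].
  + by eexists; [exact: fset22 | exact: n_sol].
  + by rewrite in_fset2 => /orP[]/eqP->; [left|right].
- exact: solves_split.
Qed.

Lemma solutionE S : solution iota S x <-> exists2 s, s \in S & solves s.
Proof.
by split=> -[s sS [eqs neq]]; exists s => //; split=> [f /eqs|];
  rewrite ?evE // -evE.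
Qed.

Lemma step_solution S T : step S T -> solution iota S x <-> solution iota T x.
Proof.
rewrite !solutionE.
case=> s [F] [N] /= [sS _ redF rep ->].
have sN : solves s <-> exists2 n, n \in N & solves n.
  by rewrite (solves_red redF); apply: solves_replacement.
split=> -[n n_in n_sol].
  have [n_eq|ns] := eqVneq n s.
    have [n' n'N n'_sol] := sN.1 (eq_ind _ solves n_sol _ n_eq).
    by exists n' => //; apply/fsetUP; right.
  have [n_eq|ns'] := eqVneq n (with_square s F).
    have n_sol' : solves (with_square s F) by rewrite -n_eq.
    have [n' n'N n'_sol] := (solves_replacement rep).1 n_sol'.
    by exists n' => //; apply/fsetUP; right.
  exists n => //; apply/fsetUP; left.
  by rewrite in_fsetD1 ns' in_fset1U in_fsetD1 ns n_in orbT.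
move: n_in => /fsetUP[/fsetD1P[n_neq /fset1UP[n_eq|/fsetD1P[_ nS]]]|nN].
- by rewrite n_eq eqxx in n_neq.
- by exists n.
- by exists s => //; apply/sN; exists n.
Qed.

End SolutionSets.

(** * Semi-triangularity *)

Section Passes.
Variables (K : fieldType) (r : nat).
Implicit Types (f g h p : {mpoly K[r]}) (s n : system K r).
Implicit Types (F G : {fset {mpoly K[r]}}) (S T N : {fset system K r}).

Lemma main_var_inj f (i j : 'I_r) : main_var f i -> main_var f j -> i = j.
Proof.
move=> [fi nfi] [fj nfj]; case: (ltngtP i j) => [lt_ij|lt_ji|/val_inj //].
  by case: nfi; apply: only_vars_fromW fj.
by case: nfj; apply: only_vars_fromW fi.
Qed.

Lemma semi_triangularP s : semi_triangular s <->
  [/\ (lvl s <= r)%N, triangular_shape (tri s),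
      {in tri s, forall f i, main_var f i -> pdvd (LC i f) (ineq s)},
      {in tri s, forall f i, main_var f i -> (i < lvl s)%N} &
      {in square s, forall f, only_vars_from (lvl s) f}].
Proof.
split=> -[ls shape_s dvd_s main_s sq_s]; split=> // f fs.
  exact/only_vars_fromP/sq_s.
exact/only_vars_fromP/sq_s.
Qed.

Lemma pdvd_mulr f g h : pdvd f g -> pdvd f (g * h).
Proof. by case=> q ->; exists (q * h); rewrite mulrAC. Qed.

Lemma pdvd_mull f g h : pdvd f g -> pdvd f (h * g).
Proof. by rewrite mulrC; apply: pdvd_mulr. Qed.

Lemma semi_triangular_red s F :
  interreduces (square s) F ->
  semi_triangular s -> semi_triangular (with_square s F).
Proof.
move=> redF /semi_triangularP[ls shape_s dvd_s main_s sq_s].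
apply/semi_triangularP; split=> //; exact: interreduces_vars redF sq_s.
Qed.

Lemma selected_neq0 (i : 'I_r) F f h : selected_pair i F f h -> h != 0.
Proof.
case=> _ _ _ deg_h _; apply: contraTneq deg_h => ->.
by rewrite degE udegE upoly0 size_poly0.
Qed.

Lemma semi_triangular_divide (i : 'I_r) s f h j a u :
    i = lvl s :> nat -> selected_pair i (square s) f h ->
    cleared_division i f h j a u -> semi_triangular s ->
  semi_triangular
    (System (u |` (square s `\ f)) (tri s) (lvl s) (LC i h * ineq s)) /\
  semi_triangular (System (LC i h |` square s) (tri s) (lvl s) (ineq s)).
Proof.
move=> is_ sel /(cleared_divisionP _ _ _ _ _ (selected_neq0 sel))[def_u ltu].
move=> /semi_triangularP[ls shape_s dvd_s main_s sq_s].
have h0 := selected_neq0 sel; case: sel => fs hs _ _ _.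
split; apply/semi_triangularP; split=> //=.
- by move=> p ps k /(dvd_s p ps); apply: pdvd_mull.
- move=> p; rewrite in_fset1U in_fsetD1 => /orP[/eqP->|/andP[_ /sq_s //]].
  apply/only_vars_fromP => l ls'; apply/varfree_deg.
  by apply: (division_free h0 def_u ltu); apply/varfree_deg;
    apply: (only_vars_fromP _ _).1 ls'; apply: sq_s.
- move=> p; rewrite in_fset1U => /orP[/eqP->|/sq_s //].
  by rewrite -is_; apply: only_vars_fromW (leqnSn i) _;
    rewrite LCE; apply: only_vars_from_ucoef; rewrite is_; apply: sq_s.
Qed.

Lemma main_var_truncation (i : 'I_r) f j : only_vars_from i f ->
  (0 < j)%N -> ucoef i f j != 0 -> main_var (truncation i f j) i.
Proof.
move=> f_vars j_gt0 fj; split.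
  exact: only_vars_from_sub (@msupp_truncation _ _ i f j) f_vars.
move=> /only_vars_fromP/(_ i (ltnSn i)); rewrite degE udeg_truncation // => j0.
by rewrite j0 in j_gt0.
Qed.

Lemma triangular_shapeU F f (i : 'I_r) : triangular_shape F -> main_var f i ->
  {in F, forall g k, main_var g k -> (k < i)%N} -> triangular_shape (f |` F).
Proof.
case=> fk [F_fk main_fk sorted_fk] f_i main_F; exists (rcons fk (f, i)); split.
- by move=> g; rewrite in_fset1U map_rcons mem_rcons inE F_fk.
- by move=> p; rewrite mem_rcons inE => /orP[/eqP->|/main_fk].
rewrite map_rcons; case: fk F_fk main_fk sorted_fk => //= p fk F_fk main_fk.
rewrite rcons_path => ->; rewrite /=.
have : last p fk \in p :: fk by apply: mem_last.
rewrite (last_map (fun p : {mpoly K[r]} * 'I_r => nat_of_ord p.2)) => last_in.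
apply: main_F (main_fk _ last_in).
by rewrite F_fk; apply: (map_f (fun q : {mpoly K[r]} * 'I_r => q.1) last_in).
Qed.

Lemma semi_triangular_split (i : 'I_r) s f :
    i = lvl s :> nat -> f \in square s -> (0 < deg i f)%N ->
    {in square s `\ f, forall h, deg i h = 0%N} -> semi_triangular s ->
  {in split_off i s f, forall n, semi_triangular n}.
Proof.
move=> is_ fs; rewrite degE => deg_f deg_F.
move=> /semi_triangularP[ls shape_s dvd_s main_s sq_s] n.
have f0 : f != 0.
  by apply: contraTneq deg_f => ->; rewrite udegE upoly0 size_poly0.
have f_vars : only_vars_from i f by rewrite is_; apply: sq_s.
have F_vars j : {in square s `\ f `|` coefs_from i f j,
    forall p, only_vars_from (lvl s).+1 p}.
  move=> p; rewrite in_fsetU => /orP[pF|]; last first.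
    move=> /(coefs_fromP _ _ _ f0)[l _ ->].
    by rewrite -is_; apply: only_vars_from_ucoef.
  apply/only_vars_fromP => l; rewrite ltnS leq_eqVlt => /orP[/eqP ls'|ls'].
    have -> : l = i by apply: val_inj; rewrite /= ls' is_.
    exact: deg_F.
  apply: (only_vars_fromP _ _).1 ls'; apply: sq_s.
  by move: pF; rewrite in_fsetD1 => /andP[].
have lsS : ((lvl s).+1 <= r)%N by rewrite -is_ ltn_ord.
rewrite in_fset1U => /orP[/eqP->|/imfsetP[j /=]].
  apply/semi_triangularP; split=> //=.
  by move=> p ps k /(main_s p ps) /ltnW; rewrite ltnS.
rewrite mem_filter mem_iota uniE coef_upoly => /andP[fj /andP[j_gt0 _]] ->.
have main_fj := main_var_truncation f_vars j_gt0 fj.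
apply/semi_triangularP; split=> //=.
- apply: triangular_shapeU shape_s main_fj _ => g gs k /(main_s g gs).
  by rewrite is_.
- move=> g; rewrite in_fset1U => /orP[/eqP-> k /(main_var_inj main_fj) <-|gs k].
    rewrite LCE udeg_truncation // ucoef_truncation leqnn.
    by exists (ineq s).
  by move=> /(dvd_s g gs); apply: pdvd_mulr.
- move=> g; rewrite in_fset1U => /orP[/eqP-> k /(main_var_inj main_fj) <-|gs k].
    by rewrite is_.
  by move=> /(main_s g gs)/ltnW.
Qed.

Lemma semi_triangular_replacement s N : replacement s N -> semi_triangular s ->
  {in N, forall n, semi_triangular n}.
Proof.
move=> [i f h j a u is_ sel _ cleared|i f is_ fs deg_f deg_F|i is_ deg_F]
  semi_s.
- have [semi1 semi2] := semi_triangular_divide is_ sel cleared semi_s.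
  by move=> n; rewrite in_fset2 => /orP[]/eqP->.
- exact: semi_triangular_split.
move=> n; rewrite in_fset1 => /eqP->; apply/semi_triangularP.
have [ls shape_s dvd_s main_s sq_s] := semi_s; split=> //=.
- by rewrite -is_ ltn_ord.
- by move=> p ps k /(main_s p ps)/ltnW.
move=> p ps; apply/only_vars_fromP => l.
rewrite ltnS leq_eqVlt => /orP[/eqP ls'|ls'].
  have -> : l = i by apply: val_inj; rewrite /= ls' is_.
  exact: deg_F.
exact: sq_s.
Qed.

Lemma step_mush S T : step S T -> triangle_mush S -> triangle_mush T.
Proof.
case=> s [F] [N] /= [sS _ [redF _ _ _] rep ->] mushS n.
rewrite in_fsetU in_fsetD1 in_fset1U in_fsetD1.
move=> /orP[/andP[n_neq /orP[n_eq|/andP[_ nS]]]|nN].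
- by rewrite n_eq in n_neq.
- exact: mushS.
apply: (semi_triangular_replacement rep) nN.
by apply: semi_triangular_red redF _; apply: mushS.
Qed.

(** * Termination *)

(** The lexicographic comparison of three quantities: the level, the sum of the
    degrees of the square part in the current variable, and the ideal of leading
    monomials of the square part. *)
Definition simpler n s : Prop :=
  (lvl s < lvl n <= r)%N \/
  lvl n = lvl s /\ exists2 i : 'I_r, i = lvl s :> nat &
    (sumdeg i (square n) < sumdeg i (square s))%N \/
    (sumdeg i (square n) <= sumdeg i (square s))%N /\
    grows (LM_ideal (square n)) (LM_ideal (square s)).

Lemma simpler_wf : well_founded simpler.
Proof.
suff H d s : (r - lvl s < d)%N -> Acc simpler s by move=> s; exact: H (ltnSn _).
elim: d s => [|d IHd] s; first by rewrite ltn0.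
rewrite ltnS => le_d.
have later n' n : lvl n = lvl s -> (lvl n < lvl n' <= r)%N -> Acc simpler n'.
  move=> -> /andP[lt_s le_r]; apply: IHd; apply: leq_trans le_d.
  by apply: ltn_sub2l => //; apply: leq_trans le_r.
have [[i is_]|no_i] := classic (exists i : 'I_r, i = lvl s :> nat); last first.
  constructor=> n [lt_s|[_ [i is_ _]]]; first exact: later lt_s.
  by case: no_i; exists i.
suff same_level D U n : lvl n = lvl s -> (sumdeg i (square n) <= D)%N ->
    LM_ideal (square n) = U -> Acc simpler n.
  exact: (same_level (sumdeg i (square s)) _ s).
elim/ltn_ind: D U n => D IHD U.
elim/(well_founded_induction (@grows_wf r)): U => U IHU n ln Dn Un.
constructor=> n' [lt_n|[ln' [i' i'n]]]; first exact: later lt_n.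
have -> : i' = i by apply: val_inj; rewrite /= i'n ln is_.
rewrite ln in ln'; case=> [ltD|[leD gr]].
  exact: (IHD _ (leq_trans ltD Dn) _ n' ln' (leqnn _)).
rewrite Un in gr; exact: (IHU _ gr n' ln' (leq_trans leD Dn)).
Qed.

(** The leading monomial of [LC h] is a proper divisor of that of [h], so in a
    reduced set no leading monomial divides it. *)
Lemma grows_LC (i : 'I_r) F h :
    {in F &, forall f1 f2, f1 != f2 -> ~ pdvd (LT f1) (LT f2)} ->
    only_vars_from i h -> h \in F -> (0 < udeg i h)%N ->
  grows (LM_ideal (LC i h |` F)) (LM_ideal F).
Proof.
move=> irred h_vars hF deg_h.
have h0 : h != 0.
  by apply: contraTneq deg_h => ->; rewrite udegE upoly0 size_poly0.
have LM_h := LM_LC h_vars h0.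
split=> [m m'|m|]; first exact: LM_ideal_up.
  by apply: LM_idealS; apply: fsubsetU1.
exists (LM (LC i h)).
  exists (LC i h); first exact: fset1U1.
  by split; [rewrite LCE ucoef_udeg_neq0 | apply: lepm_refl].
case=> f fF [f0 le_f]; have [fh|fh] := eqVneq f h.
  move: le_f => /mnm_lepP/(_ i); rewrite fh LM_h mnm_shift.
  by rewrite -[X in (_ <= X)%N]addn0 leq_add2l leqNgt deg_h.
apply: (irred f h fF hF fh); apply: pdvd_LT => //.
by apply: lepm_trans le_f _; rewrite LM_h lem_addr.
Qed.

Lemma replacement_simpler s F N : semi_triangular s -> is_red (square s) F ->
  replacement (with_square s F) N -> {in N, forall n, simpler n s}.
Proof.
move=> semi_s [redF irred _ _] rep.
have semi_F := semi_triangular_red redF semi_s.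
have next_simpler (i : 'I_r) n :
    i = lvl s :> nat -> lvl n = (lvl s).+1 -> simpler n s.
  by move=> is_ ln; left; rewrite ln leqnn -is_ ltn_ord.
case: rep => [i f h j a u /= is_ sel _ cleared|i f /= is_ _ _ _|i /= is_ _] n.
- have [_ _ _ _ sq_s] := (semi_triangularP s).1 semi_s.
  have [_ _ _ _ sq_F] := (semi_triangularP _).1 semi_F.
  rewrite /= -is_ in sq_s sq_F.
  have [_ ltu] := (cleared_divisionP _ _ _ _ _ (selected_neq0 sel)).1 cleared.
  case: sel => fF hF _; rewrite !degE => deg_h le_hf.
  have leF := interreduces_sumdeg redF sq_s.
  rewrite in_fset2 => /orP[]/eqP->; right; split=> //; exists i => //=;
    [left|right].
    apply: leq_trans leF; rewrite (sumdegD1 i fF).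
    apply: leq_ltn_trans (sumdeg_fset1U _ _ _) _; rewrite ltn_add2r.
    exact: leq_trans (udeg_lt_size deg_h ltu) le_hf.
  split.
    apply: leq_trans leF; apply: leq_trans (sumdeg_fset1U _ _ _) _.
    by rewrite (eqP (varfree_LC i h)).
  have [up _ [m m_new m_old]] := grows_LC irred (sq_F h hF) hF deg_h.
  split=> [//|m' m'_in|].
    apply: (@LM_idealS _ _ F); first exact: fsubsetU1.
    exact: interreduces_LM_ideal redF m'_in.
  by exists m => // m_in; apply: m_old; apply: interreduces_LM_ideal redF m_in.
- rewrite in_fset1U => /orP[/eqP->|/imfsetP[j _ ->]]; exact: (next_simpler i).
- by rewrite in_fset1 => /eqP->; apply: (next_simpler i).
Qed.

Lemma step_below S T : triangle_mush S -> step S T -> fset_below simpler T S.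
Proof.
move=> mushS [s [F] [N] /= [sS _ redF rep ->]]; exists s => // n.
move=> /fsetUP[/fsetD1P[n_neq /fset1UP[n_eq|n_in]]|nN].
- by rewrite n_eq eqxx in n_neq.
- by left.
by right; apply: replacement_simpler redF rep _ nN; apply: mushS.
Qed.

Lemma step_wf S : triangle_mush S -> Acc (fun T' T => step T T') S.
Proof.
elim/(well_founded_induction (fset_below_wf simpler_wf)): S => S IHS mushS.
constructor=> T stepT; apply: IHS; first exact: step_below stepT.
exact: step_mush stepT mushS.
Qed.

Lemma replacement_exists s : (lvl s < r)%N -> exists N, replacement s N.
Proof.
move=> lt_s; pose i := Ordinal lt_s; set F := square s.
have [[f fF deg_f]|no_f] := classic (exists2 f, f \in F & (0 < deg i f)%N);
  last first.
  exists [fset System F (tri s) (lvl s).+1 (ineq s)].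
  apply: (@CaseSkip _ _ _ i) => //.
  move=> f fF; apply/eqP; rewrite -leqn0 leqNgt; apply/negP => deg_f.
  by apply: no_f; exists f.
have [[h [hF hf deg_h]]|no_h] :=
    classic (exists h, [/\ h \in F, h != f & (0 < deg i h)%N]); last first.
  exists (split_off i s f); apply: CaseSplit => // h.
  rewrite in_fsetD1 => /andP[hf hF]; apply/eqP; rewrite -leqn0 leqNgt.
  by apply/negP => deg_h; apply: no_h; exists h.
have [f' [h' sel]] : exists f' h', selected_pair i F f' h'.
  have [le_hf|le_fh] := leqP (deg i h) (deg i f); first by exists f, h.
  exists h, f; split; [exact: hF | exact: fF | | exact: deg_f | exact: ltnW].
  by rewrite eq_sym.
have [j exp_j] := exponent_exists i f' (selected_neq0 sel).
have [_ [a [u cleared]] _] := exp_j.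
by eexists; apply: CaseDivide sel exp_j cleared.
Qed.

Lemma executable_lt s : (lvl s < r)%N -> executable s.
Proof.
move=> lt_s; split; first exact: is_red_exists.
move=> F _; split; first exact: replacement_exists.
by move=> i f h _ /selected_neq0; apply: exponent_exists.
Qed.

Lemma reachable_mush S T : reachable S T -> triangle_mush S -> triangle_mush T.
Proof. by elim=> [U V|//|U V W _ IHU _ IHV /IHU/IHV //]; apply: step_mush. Qed.

Lemma reachable_solution (L : closedFieldType) (iota : {rmorphism K -> L}) S T :
  reachable S T -> equivalent iota S T.
Proof.
elim=> [U V stepUV x|//|U V W _ IHU _ IHV x]; first exact: step_solution stepUV.
by rewrite IHU.
Qed.

Lemma semi_triangular_final s : semi_triangular s -> ~ (lvl s < r)%N ->
  triangular_system s.
Proof.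
move=> semi_s /negP; rewrite -leqNgt => le_r; split=> // f fs.
have [_ _ _ _ /(_ f fs) f_vars] := (semi_triangularP s).1 semi_s.
exists f@_0%MM; apply/mpolyP => m; rewrite mcoeffC.
have [->|m0] := eqVneq m 0%MM; first by rewrite mulr1.
rewrite mulr0; apply/eqP; rewrite mcoeff_eq0; apply: contra m0 => m_in.
apply/eqP/mnmP => i; rewrite mnm0E; apply: f_vars m_in _ _.
by apply: leq_trans le_r.
Qed.

End Passes.

Theorem mainTheorem2 (K : fieldType) (L : closedFieldType)
    (iota : {rmorphism K -> L}) (algL : forall x : L, algebraicOver iota x)
    (r : nat) (S : {fset system K r}) (mushS : triangle_mush S) :
  terminates S /\
  (forall S', output S S' ->
     [/\ triangle_mush S', equivalent iota S S' &
         {in S', forall s, triangular_system s}]).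
Proof.
split.
  split; first exact: step_wf.
  by move=> T s _ _; apply: executable_lt.
move=> S' [reachS' final]; have mushS' := reachable_mush reachS' mushS.
split=> // [|s sS']; first exact: reachable_solution.
by apply: semi_triangular_final; [apply: mushS' | apply: final].
Qed.
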